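(* There is an absolute constant $c_1>0$ such that for every fixed $\epsilon$ with $0<\epsilon<\frac1{100}$, with high probability, for every integer $k$ with $k_1:=\sqrt{\frac{c_1 n}{\log n}}\le k<\epsilon^3 n$, \[|\mathcal L_k\setminus C_{\tau_{\mathrm{end}}}|\ge \frac{(1-\rho)\,e^{-\frac{10n}{9k}}}{2}\binom nk,\qquad\text{where }\ \rho=\max\left(1-\Big(\frac{k+1}{en}\Big)^{100},\ 1-\Big(\frac1{10e}\Big)^{10}\right).\]
   Context: Let $n\ge 1$ and $\mathcal B=\{0,1\}^n$ with the coordinatewise partial order; $\mathbf 0=(0,\dots,0)$, $\mathbf 1=(1,\dots,1)$, $|x|$ denotes the number of ones of $x$, and $\mathcal L_k=\{x\in\mathcal B:|x|=k\}$ is the $k$th level, so $|\mathcal L_k|=\binom nk$. A random decreasing walk from $\mathbf 1$ is a maximal chain $\mathbf 1=x_n>x_{n-1}>\dots>x_0=\mathbf 0$ with $x_i\in\mathcal L_i$, chosen uniformly among all $n!$ such chains (equivalently, each step turns a uniformly random remaining $1$ into $0$). The DLA process on $\mathcal B$: $C_0=\{\mathbf 0\}$; for $t\ge1$, let $\rho_t$ be a random decreasing walk from $\mathbf 1$, independent of everything before; let $v$ be the last vertex of the longest initial segment of $\rho_t$ that is disjoint from $C_{t-1}$, and set $C_t=C_{t-1}\cup\{v\}$. The process terminates at the first time $\tau_{\mathrm{end}}$ with $\mathbf 1\in C_{\tau_{\mathrm{end}}}$ (for $t>\tau_{\mathrm{end}}$ put $C_t=C_{\tau_{\mathrm{end}}}$).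 A vertex is occupied at time $t$ if it lies in $C_t$. ''With high probability'' (w.h.p.) means with probability tending to $1$ as $n\to\infty$; $\log$ is the natural logarithm. *)

(* Defs.v *)
From Stdlib Require Import Reals ClassicalEpsilon.
From mathcomp Require Import all_boot all_fingroup.

Set Implicit Arguments.
Unset Strict Implicit.
Unset Printing Implicit Defensive.

(* A vertex x of the hypercube {0,1}^n is identified with the set of its
   coordinates equal to 1; |x| = #|x|, the coordinatewise order is inclusion,
   the all-ones vertex is setT and the all-zeros vertex is set0. *)
Definition vertex (n : nat) := {set 'I_n}.
Definition cluster (n : nat) := {set {set 'I_n}}.

(* Decreasing walk from 1 determined by a permutation s of the coordinates:
   at step i (0-based) coordinate s i is turned into 0.  After j steps the
   walk is at the vertex with ones exactly outside {s i | i < j}.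
   The uniform distribution on 'S_n gives the uniform distribution on the
   n! maximal chains. *)
Definition walk (n : nat) (s : 'S_n) (j : nat) : {set 'I_n} :=
  setT :\: [set s i | i : 'I_n & (i < j)%N].

Definition first_hit (n : nat) (C : cluster n) (s : 'S_n) : nat :=
  find (fun j => walk s j \in C) (iota 0 n.+1).

(* Vertex added to C: the last vertex of the longest initial segment of the
   walk disjoint from C. *)
Definition new_vertex (n : nat) (C : cluster n) (s : 'S_n) : {set 'I_n} :=
  walk s (first_hit C s).-1.

Definition dla_step (n : nat) (C : cluster n) (s : 'S_n) : cluster n :=
  new_vertex C s |: C.

Local Open Scope R_scope.

Definition indic (T : Type) (E : T -> Prop) (x : T) : R :=
  if excluded_middle_informative (E x) then R1 else R0.

(* Probability that the final cluster C_{tau_end} satisfies E, starting from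
   cluster C, with at most [fuel] further steps.  Each step before termination
   adds a new vertex, so fuel 2^n always suffices. *)
Fixpoint reach (n : nat) (fuel : nat) (C : cluster n)
    (E : cluster n -> Prop) : R :=
  if (setT : {set 'I_n}) \in C then indic E C else
  match fuel with
  | 0 => R0
  | f.+1 => / INR (n`!)%N *
             \big[Rplus/R0]_(s : 'S_n) reach f (dla_step C s) E
  end.

Definition dla_prob (n : nat) (E : cluster n -> Prop) : R :=
  reach (2 ^ n)%N [set (set0 : {set 'I_n})] E.

Definition unocc_level (n : nat) (C : cluster n) (k : nat) : nat :=
  #|[set x : {set 'I_n} | (#|x| == k) && (x \notin C)]|.

Definition rho (n k : nat) : R :=
  Rmax (1 - (INR (k + 1)%N / (exp 1 * INR n)) ^ 100)
       (1 - (1 / (10 * exp 1)) ^ 10).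

Definition event4 (c1 eps : R) (n : nat) (C : cluster n) : Prop :=
  forall k : nat,
    sqrt (c1 * INR n / ln (INR n)) <= INR k ->
    INR k < eps ^ 3 * INR n ->
    (1 - rho n k) * exp (- (10 * INR n / (9 * INR k))) / 2 * INR 'C(n, k)
       <= INR (unocc_level C k).

(* Main.v *)
(** The key quantity on level [k] is the total weight
      [sum over unoccupied x in L_k of g ^ (number of occupied upper neighbours of x)],
    with [g = 1 + 20 / (19 (k + 1))]. A walk arriving at an unoccupied [y] in
    [L_(k+1)] moves to a uniform lower neighbour; if that one is occupied, [y]
    becomes occupied and is never visited again. So if every [y] in [L_(k+1)]
    has at least [19/20] of its lower neighbours occupied, the total weight has
    nonnegative drift. It moves by at most [2 g ^ (n - k)], and only when a
    vertex of [L_k] or [L_(k+1)] is added, hence at most [C(n, k) + C(n, k+1)]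
    times; an exponential supermartingale then shows that it rarely halves. As
    each weight is at most [g ^ (n - k) <= exp (20 n / (19 k))], many vertices
    of [L_k] stay unoccupied for ever.

    The condition on [L_(k+1)] holds at time [C(n, k+1) / 100], when at least
    [C(n, k) exp (- n / (25 k)) / 2] vertices of [L_k] are still unoccupied. It is
    proved by induction on the level [i]: until time [C(n, i+1) / 100] few walks
    through a vertex of [L_i] are blocked from above, so given the condition on
    [L_i] a set [S] of [(i + 1) / 20] lower neighbours of a vertex of [L_(i+1)]
    remains unoccupied with probability exponentially small in [n], small enough
    for a union bound over all these sets because [i <= n / 10^6]. *)
From HB Require Import structures.
From Stdlib Require Import Reals Lra ClassicalEpsilon.
From mathcomp Require Import all_boot all_fingroup.
From mathcomp Require Import zify.
Require Import Defs.

Set Implicit Arguments.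
Unset Strict Implicit.
Unset Printing Implicit Defensive.

Local Open Scope R_scope.

(** * Finite sums of real numbers and indicators *)

Fact Rplus_associative : associative Rplus.
Proof. by move=> x y z; rewrite Rplus_assoc. Qed.

HB.instance Definition _ :=
  Monoid.isComLaw.Build R 0 Rplus Rplus_associative Rplus_comm Rplus_0_l.
HB.instance Definition _ :=
  Monoid.isMulLaw.Build R 0 Rmult Rmult_0_l Rmult_0_r.
HB.instance Definition _ :=
  Monoid.isAddLaw.Build R Rmult Rplus
    (fun x y z => Rmult_plus_distr_r x y z) Rmult_plus_distr_l.

Section RealSums.
Variables (I : Type) (r : seq I) (P : pred I).
Implicit Types F G : I -> R.

Lemma rsum_le F G : (forall i, P i -> F i <= G i) ->
  \big[Rplus/0]_(i <- r | P i) F i <= \big[Rplus/0]_(i <- r | P i) G i.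
Proof. by move=> FG; elim/big_ind2: _ => // *; lra. Qed.

Lemma rsum_ge0 F : (forall i, P i -> 0 <= F i) ->
  0 <= \big[Rplus/0]_(i <- r | P i) F i.
Proof. by move=> F0; elim/big_ind: _ => // *; lra. Qed.

Lemma rsum_mull c F :
  c * \big[Rplus/0]_(i <- r | P i) F i = \big[Rplus/0]_(i <- r | P i) (c * F i).
Proof. exact: big_distrr. Qed.

Lemma rsum_sub F G :
  \big[Rplus/0]_(i <- r | P i) (F i - G i) =
  \big[Rplus/0]_(i <- r | P i) F i - \big[Rplus/0]_(i <- r | P i) G i.
Proof. by elim/big_rec3: _ => [|i x y z _ ->]; lra. Qed.

Lemma INR_sum (F : I -> nat) :
  INR (\sum_(i <- r | P i) F i)%N = \big[Rplus/0]_(i <- r | P i) INR (F i).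
Proof. by elim/big_rec2: _ => // i x y _ <-; rewrite -plusE plus_INR. Qed.

End RealSums.

Lemma rsum_const (I : finType) (P : pred I) (c : R) :
  \big[Rplus/0]_(i | P i) c = INR #|P| * c.
Proof.
rewrite -sum1_card INR_sum Rmult_comm rsum_mull.
by apply: eq_bigr => i _; rewrite Rmult_1_r.
Qed.

Lemma rsum_const_set (I : finType) (A : {set I}) (c : R) :
  \big[Rplus/0]_(i in A) c = INR #|A| * c.
Proof. by rewrite rsum_const; congr (INR _ * _); apply: eq_card. Qed.

Lemma rsum_subset_le (I : finType) (P Q : pred I) (F : I -> R) :
  (forall i, P i -> Q i) -> (forall i, Q i -> 0 <= F i) ->
  \big[Rplus/0]_(i | P i) F i <= \big[Rplus/0]_(i | Q i) F i.
Proof.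
move=> PQ F0; rewrite (bigID P Q) /=.
have -> : \big[Rplus/0]_(i | Q i && P i) F i = \big[Rplus/0]_(i | P i) F i.
  by apply: eq_bigl => i; case Pi: (P i); rewrite ?andbT ?andbF // PQ.
have := @rsum_ge0 _ (index_enum I) (fun i => Q i && ~~ P i) F.
by case=> [i /andP[/F0]||] //; lra.
Qed.

Lemma leq_INR (a b : nat) : (a <= b)%N -> INR a <= INR b.
Proof. by move=> /leP; exact: le_INR. Qed.

Lemma INR_gt0 (a : nat) : (0 < a)%N -> 0 < INR a.
Proof. by move=> /ltP; exact: lt_0_INR. Qed.

Lemma INRM (a b : nat) : INR (a * b)%N = INR a * INR b.
Proof. by rewrite -multE mult_INR. Qed.

Lemma INRD (a b : nat) : INR (a + b)%N = INR a + INR b.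
Proof. by rewrite -plusE plus_INR. Qed.

Lemma INRB (a b : nat) : (b <= a)%N -> INR (a - b)%N = INR a - INR b.
Proof. by move=> /leP ba; rewrite -minusE minus_INR. Qed.

Lemma INRX (a b : nat) : INR (a ^ b)%N = INR a ^ b.
Proof. by elim: b => // b IH; rewrite expnS INRM IH. Qed.

Lemma Rle_divr a b c : 0 < c -> a * c <= b -> a <= b / c.
Proof.
by move=> c0 acb; apply: (Rmult_le_reg_r c) => //; have -> : b / c * c = b by field; lra.
Qed.

Lemma Rle_divl a b c : 0 < c -> a <= b * c -> a / c <= b.
Proof.
by move=> c0 acb; apply: (Rmult_le_reg_r c) => //; have -> : a / c * c = a by field; lra.
Qed.

Section Indicators.
Variables (T : Type) (E : T -> Prop).

Lemma indicT x : E x -> indic E x = 1.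
Proof. by rewrite /indic; case: excluded_middle_informative. Qed.

Lemma indicF x : ~ E x -> indic E x = 0.
Proof. by rewrite /indic; case: excluded_middle_informative. Qed.

Lemma indic_ge0 x : 0 <= indic E x.
Proof. by rewrite /indic; case: excluded_middle_informative => ? /=; lra. Qed.

Lemma indic_le1 x : indic E x <= 1.
Proof. by rewrite /indic; case: excluded_middle_informative => ? /=; lra. Qed.

Lemma indic_le x r : 0 <= r -> (E x -> 1 <= r) -> indic E x <= r.
Proof.
by rewrite /indic => r0 er; case: excluded_middle_informative => // /er.
Qed.

End Indicators.

(** * Walks and the uniform random chain *)

Section Walks.
Variable n : nat.
Implicit Types (s : 'S_n) (w x y z : {set 'I_n}) (C : cluster n).

Lemma in_walk s j (a : 'I_n) : (a \in walk s j) = (j <= (s^-1)%g a)%N.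
Proof.
rewrite /walk !inE andbT leqNgt; congr (~~ _).
apply/imsetP/idP => [[i]|lt_j].
  by rewrite inE => lt_ij ->; rewrite permK.
by exists ((s^-1)%g a); rewrite ?inE // permKV.
Qed.

Lemma walk0 s : walk s 0 = setT.
Proof. by apply/setP => a; rewrite in_walk !inE. Qed.

Lemma walkn s : walk s n = set0.
Proof. by apply/setP => a; rewrite in_walk !inE leqNgt ltn_ord. Qed.

Lemma walk_sub s i j : (i <= j)%N -> walk s j \subset walk s i.
Proof. by move=> ij; apply/subsetP => a; rewrite !in_walk; exact: leq_trans. Qed.

Lemma card_walk s j : (j <= n)%N -> #|walk s j| = (n - j)%N.
Proof.
move=> jn; rewrite /walk cardsD setTI cardsT card_ord; congr (n - _)%N.
rewrite card_imset; last exact: perm_inj.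
by rewrite -sum1dep_card -(big_ord_widen n (fun=> 1%N) jn) sum1_card card_ord.
Qed.

Lemma walkM s (t : 'S_n) j a : (a \in walk (s * t)%g j) = ((t^-1)%g a \in walk s j).
Proof. by rewrite !in_walk invMg permM. Qed.

Lemma walk_tperm s a b j : a \in walk s j -> b \in walk s j ->
  walk (s * tperm a b)%g j = walk s j.
Proof.
move=> aw bw; apply/setP => c; rewrite walkM tpermV.
by case: tpermP => [->|->|]; rewrite ?aw ?bw.
Qed.

Lemma walk_tperm_swap s a b j : a \in walk s j -> b \notin walk s j ->
  walk (s * tperm a b)%g j = b |: (walk s j :\ a).
Proof.
move=> aw bw; apply/setP => c; rewrite walkM tpermV in_setU1 in_setD1.
case: tpermP => [->|->|/eqP ca /eqP cb].
- rewrite eqxx (negPf bw) /=; apply/esym/negbTE; rewrite orbF.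
  by apply: contraNneq bw => <-.
- by rewrite eqxx aw.
- by rewrite (negPf cb) ca.
Qed.

End Walks.

(** Induction on [#|z :\: z'|]: exchanging an element of [z] outside [z'] for one of [z'] outside
    [z] keeps the size and the inclusion in [w], and brings [z] closer to [z']. *)
Lemma swap_invariant_const (T : finType) (f : {set T} -> nat) (w : {set T}) :
  (forall (z : {set T}) a b, z \subset w -> a \in z -> b \in w -> b \notin z ->
     f z = f (b |: (z :\ a))) ->
  forall z z' : {set T}, z \subset w -> z' \subset w -> #|z| = #|z'| -> f z = f z'.
Proof.
move=> fswap z z'; have [d] := ubnP #|z :\: z'|.
elim: d z => // d IH z lt_d zw zw' zz'.
have [/eqP|[a]] := set_0Vmem (z :\: z').
  by rewrite setD_eq0 => sub; congr f; apply/eqP; rewrite eqEcard sub zz' /=.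
rewrite inE => /andP[az' az].
have /card_gt0P[b] : (0 < #|z' :\: z|)%N.
  have := cardsID z' z; have := cardsID z z'; rewrite setIC.
  have : (0 < #|z :\: z'|)%N by apply/card_gt0P; exists a; rewrite inE az' az.
  by lia.
rewrite inE => /andP[bz bz'].
have bw : b \in w by apply: (subsetP zw').
rewrite (fswap z a b) //; apply: IH => //.
- apply: leq_trans (_ : #|z :\: z'| <= d)%N; last by rewrite -ltnS.
  apply: proper_card; apply/properP; split; last first.
    exists a; rewrite !inE ?az' ?az ?eqxx //= orbF.
    by apply: contraNneq bz => <-.
  apply/subsetP => c; rewrite !inE => /andP[cz' /orP[/eqP cb|/andP[_ ->]]].
    by rewrite cb bz' in cz'.
  by rewrite cz'.
- by rewrite subUset sub1set bw (subset_trans (subsetDl _ _) zw).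
- rewrite cardsU1 !inE negb_and bz orbT -zz'.
  by have := cardsD1 a z; rewrite az => ->.
Qed.

(** * Probabilities that the uniform walk passes through given vertices *)

Section Chains.
Variable n : nat.
Implicit Types (s : 'S_n) (w x y z : {set 'I_n}) (C : cluster n).

(** A walk is on level [#|w|] exactly at time [n - #|w|], so one test decides whether it visits
    [w]. *)
Definition passes s w := walk s (n - #|w|) == w.

Definition avoids C s j := [forall i : 'I_j.+1, walk s i \notin C].

Definition reaches C s w := avoids C s (n - #|w|) && passes s w.

Definition attaches C s w :=
  reaches C s w && (walk s (n - #|w|).+1 \in C).

Lemma avoidsP C s j :
  reflect (forall i, (i <= j)%N -> walk s i \notin C) (avoids C s j).
Proof.
apply: (iffP forallP) => [H i ij|H i]; last exact/H/leq_ord.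
exact: (H (Ordinal (ij : (i < j.+1)%N))).
Qed.

Lemma card_le_n w : (#|w| <= n)%N.
Proof. by rewrite -[X in (_ <= X)%N]card_ord max_card. Qed.

Lemma card_walk_sub s i : (i <= n)%N -> #|walk s (n - i)| = i.
Proof. by move=> i_n; rewrite card_walk ?leq_subr // subKn. Qed.

Lemma sum_passes_sub s w i : (i <= #|w|)%N -> passes s w ->
  (\sum_(z : {set 'I_n} | (z \subset w) && (#|z| == i)) passes s z)%N = 1%N.
Proof.
move=> iw pw; have i_n := leq_trans iw (card_le_n w).
have sub : walk s (n - i) \subset w.
  by move/eqP: pw => {1}<-; apply/walk_sub/leq_sub2l.
rewrite (bigD1 (walk s (n - i))) /=; last by rewrite sub card_walk_sub /=.
rewrite big1 ?addn0 => [|z /andP[/andP[_ /eqP zi]]]; rewrite /passes.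
  by rewrite card_walk_sub ?eqxx.
by rewrite zi eq_sym => /negbTE ->.
Qed.

(* Right multiplication by a transposition of two elements of [w] does not
   change the part of the walk above [w], so all subsets of [w] of a given size
   are equally likely to be visited afterwards. *)
Lemma card_passes_sub (A : pred 'S_n) w z :
  (forall s a b, a \in w -> b \in w -> passes s w -> A s ->
     A (s * tperm a b)%g) ->
  z \subset w ->
  (#|[pred s | [&& A s, passes s w & passes s z]]| * 'C(#|w|, #|z|) =
   #|[pred s | A s && passes s w]|)%N.
Proof.
move=> Ainv zw; set i := #|z|.
pose f (v : {set 'I_n}) := (\sum_s [&& A s, passes s w & walk s (n - i) == v])%N.
have f_le (v : {set 'I_n}) a b : v \subset w -> a \in v -> b \in w -> b \notin v ->
    (f v <= f (b |: (v :\ a)))%N.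
  move=> vw av bw bv; rewrite /f [X in (_ <= X)%N](reindex_inj (mulIg (tperm a b))).
  apply: leq_sum => s _; case: and3P => // -[As pw /eqP wv].
  have aw := subsetP vw _ av.
  rewrite Ainv //= /passes walk_tperm ?(eqP pw) //= -wv.
  by rewrite walk_tperm_swap ?wv ?eqxx.
(* The inverse exchange gives the reverse inequality. *)
have f_swap (v : {set 'I_n}) a b : v \subset w -> a \in v -> b \in w -> b \notin v ->
    f v = f (b |: (v :\ a)).
  move=> vw av bw bv; apply/eqP; rewrite eqn_leq f_le //=.
  have aw := subsetP vw _ av.
  have ab : a != b by apply: contraNneq bv => <-.
  have {2}-> : v = a |: ((b |: (v :\ a)) :\ b).
    apply/setP => c; rewrite !inE; case: (eqVneq c a) => [->|ca] //=.
    by case: (eqVneq c b) => [->|cb] //=; apply: negbTE.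
  apply: f_le => //; rewrite ?inE ?eqxx ?(negPf ab) //.
  by rewrite subUset sub1set bw (subset_trans (subsetDl _ _) vw).
have fE : #|[pred s | [&& A s, passes s w & passes s z]]| = f z.
  by rewrite -sum1_card big_mkcond; apply: eq_bigr => s _; rewrite inE /passes -/i; case: ifP.
(* A walk through [w] visits exactly one subset of [w] of size [i], so the values of [f] on these
   subsets add up to the number of walks in [A] through [w]. *)
have -> : #|[pred s | A s && passes s w]| =
    (\sum_(v : {set 'I_n} | (v \subset w) && (#|v| == i)) f v)%N.
  rewrite -sum1_card big_mkcond exchange_big; apply: eq_bigr => s _ /=.
  rewrite inE; case: ifP => [/andP[-> pw]|/negbT] /=; last first.
    by move=> Apw; rewrite big1 // => v _; rewrite andbA (negbTE Apw).
  rewrite pw -(sum_passes_sub (subset_leq_card zw) pw); apply: eq_bigr => v /andP[_ /eqP vi].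
  by rewrite /passes vi.
rewrite fE (eq_bigr (fun=> f z)) => [|v /andP[vw /eqP vi]]; last first.
  exact: (swap_invariant_const f_swap).
by rewrite sum_nat_const -cards_draws mulnC; congr (_ * _)%N; apply: eq_card => v; rewrite !inE.
Qed.

Definition pr (A : pred 'S_n) : R := / INR n`! * INR #|A|.

Lemma fact_gt0R : 0 < INR n`!.
Proof. exact/INR_gt0/fact_gt0. Qed.

Lemma prE A : pr A = / INR n`! * \big[Rplus/0]_s INR (A s).
Proof.
rewrite /pr -sum1_card INR_sum big_mkcond; congr (_ * _).
by apply: eq_bigr => s _; rewrite unfold_in; case: (A s).
Qed.

Lemma pr_ge0 A : 0 <= pr A.
Proof.
by apply: Rmult_le_pos (pos_INR _); apply/Rlt_le/Rinv_0_lt_compat/fact_gt0R.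
Qed.

Lemma pr_le (A B : pred 'S_n) : (forall s, A s -> B s) -> pr A <= pr B.
Proof.
move=> AB; apply: Rmult_le_compat_l.
  exact/Rlt_le/Rinv_0_lt_compat/fact_gt0R.
by apply/leq_INR/subset_leq_card/subsetP.
Qed.

Lemma pr_union_le (I : finType) (P : pred I) (A : pred 'S_n) (B : I -> pred 'S_n) :
  (forall s, A s -> exists2 i, P i & B i s) ->
  pr A <= \big[Rplus/0]_(i | P i) pr (B i).
Proof.
move=> AB; under eq_bigr do rewrite prE.
rewrite -rsum_mull exchange_big /= prE; apply: Rmult_le_compat_l.
  exact/Rlt_le/Rinv_0_lt_compat/fact_gt0R.
apply: rsum_le => s _; case As: (A s); last first.
  by apply: rsum_ge0 => i _; apply: pos_INR.
have [i Pi Bi] := AB s As; rewrite (bigD1 i) //= Bi -[X in X <= _]Rplus_0_r.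
apply/Rplus_le_compat_l/rsum_ge0 => j _; exact: pos_INR.
Qed.

Lemma bin_gt0R m k : (k <= m)%N -> 0 < INR 'C(m, k).
Proof. by move=> km; apply: INR_gt0; rewrite bin_gt0. Qed.

Lemma pr_passes_sub (A : pred 'S_n) w z :
  (forall s a b, a \in w -> b \in w -> passes s w -> A s ->
     A (s * tperm a b)%g) ->
  z \subset w ->
  pr [pred s | [&& A s, passes s w & passes s z]] =
  pr [pred s | A s && passes s w] / INR 'C(#|w|, #|z|).
Proof.
move=> Ainv zw; have b0 := bin_gt0R (subset_leq_card zw).
have aux (f a b c : R) : 0 < b -> a * b = c -> f * a = f * c / b.
  by move=> ? <-; field; lra.
by apply: aux => //; rewrite -INRM (card_passes_sub Ainv zw).
Qed.

(** This is [pr_passes_sub] from the vertex [setT], where every walk starts. *)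
Lemma pr_passes w : pr [pred s | passes s w] = / INR 'C(n, #|w|).
Proof.
have := @pr_passes_sub predT setT w (fun _ _ _ _ _ _ _ => isT) (subsetT w).
have passT s : passes s setT by rewrite /passes cardsT card_ord subnn walk0.
have -> : pr [pred s | predT s && passes s setT] = 1.
  rewrite /pr (eq_card (B := 'S_n)) ?card_Sn; last by move=> s; rewrite !inE passT.
  by rewrite Rinv_l //; have := fact_gt0R; lra.
rewrite cardsT card_ord /Rdiv Rmult_1_l => <-.
by congr (/ _ * INR _); apply: eq_card => s; rewrite !inE passT.
Qed.

(** The product is arranged so that its second factor is the inverse of the probability that a walk
    through [z] has come through [w]; [blocking] sums these probabilities. *)
Lemma pr_passes2 w z : z \subset w ->
  pr [pred s | passes s w && passes s z] =
  / (INR 'C(n, #|z|) * INR 'C(n - #|z|, #|w| - #|z|)).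
Proof.
move=> zw; have zw' := subset_leq_card zw; have wn := card_le_n w.
have := @pr_passes_sub predT w z (fun _ _ _ _ _ _ _ => isT) zw.
rewrite pr_passes => ->.
have -> : INR 'C(n, #|z|) * INR 'C(n - #|z|, #|w| - #|z|) = INR 'C(n, #|w|) * INR 'C(#|w|,
  #|z|).
  rewrite -!INRM; congr INR; apply/eqP.
  have f0 : (0 < #|z|`! * (#|w| - #|z|)`! * (n - #|w|)`!)%N by rewrite !muln_gt0 !fact_gt0.
  rewrite -(eqn_pmul2r f0); apply/eqP.
  have E1 := bin_fact (leq_trans zw' wn).
  have E2 := bin_fact (leq_sub2r #|z| wn).
  have E3 := bin_fact wn; have E4 := bin_fact zw'.
  have E5 : (n - #|z| - (#|w| - #|z|) = n - #|w|)%N by lia.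
  transitivity n`!; first by rewrite -E1 -E2 E5; nia.
  by rewrite -E3 -E4; nia.
have := bin_gt0R wn; have := bin_gt0R zw'; move=> ? ?; field; lra.
Qed.

End Chains.

(** * Probabilities of attaching at a vertex, and the one-step operator *)

Section Attachment.
Variable n : nat.
Implicit Types (s : 'S_n) (w x y z : {set 'I_n}) (C : cluster n).

(** Every vertex visited up to [w] contains both [a] and [b], so the transposition does not move it.
    This is the invariance that [pr_passes_sub] requires. *)
Lemma avoids_tperm C s w a b : a \in w -> b \in w -> passes s w ->
  avoids C s (n - #|w|) -> avoids C (s * tperm a b)%g (n - #|w|).
Proof.
move=> aw bw /eqP pw /avoidsP av; apply/avoidsP => i i_le.
have sub := walk_sub s i_le; rewrite pw in sub.
by rewrite walk_tperm ?(subsetP sub) //; apply: av.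
Qed.

Lemma avoidsW C s i j : (i <= j)%N -> avoids C s j -> avoids C s i.
Proof.
by move=> ij /avoidsP av; apply/avoidsP => l li; apply/av/(leq_trans li).
Qed.

Lemma walkK s j : (j <= n)%N -> (n - #|walk s j|)%N = j.
Proof. by move=> jn; rewrite card_walk // subKn. Qed.

Lemma reaches_notin C s w : reaches C s w -> w \notin C.
Proof. by case/andP=> /avoidsP av /eqP <-; apply: av. Qed.

Lemma attaches_uniq C s w w' : attaches C s w -> attaches C s w' -> w = w'.
Proof.
move=> /andP[/andP[/avoidsP av /eqP pw] nw] /andP[/andP[/avoidsP av' /eqP pw'] nw'].
rewrite -pw -pw'; congr (walk s _).
case: (ltngtP (n - #|w|)%N (n - #|w'|)%N) => // [/av'|/av].
  by rewrite nw.
by rewrite nw'.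
Qed.

(** Since [set0] is occupied, every walk meets the cluster. The left case is the terminated process,
    where the step adds nothing new. *)
Lemma new_vertexP C s : set0 \in C ->
  [/\ setT \in C, new_vertex C s \in C & forall w, ~~ attaches C s w] \/
  (attaches C s (new_vertex C s)).
Proof.
move=> C0; rewrite /new_vertex /first_hit.
set P := fun j => walk s j \in C.
have hasP : has P (iota 0 n.+1).
  by apply/hasP; exists n; rewrite ?mem_iota ?ltnSn //= /P walkn.
have lt_h : (find P (iota 0 n.+1) < n.+1)%N by rewrite -{2}(size_iota 0 n.+1) -has_find.
have := nth_find 0%N hasP; rewrite nth_iota // add0n.
have := @before_find _ 0%N P (iota 0 n.+1).
(* A hit at index [0] means that [setT] is occupied; the predecessor of [0] is [0], so the step then
   adds [setT] again. *)
case: (find P (iota 0 n.+1)) lt_h => [|h] lt_h bf Ph.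
  left; split=> [||w] //; first by rewrite -(walk0 s).
  apply/negP => /andP[/andP[/avoidsP/(_ 0%N (leq0n _))]].
  by rewrite -/(P 0%N) Ph.
right; rewrite /attaches /reaches /passes /= walkK; last by lia.
rewrite eqxx andbT; apply/andP; split=> //; apply/avoidsP => i ih.
by have := bf i ih; rewrite nth_iota ?add0n ?/P; [move=> ->|lia].
Qed.

Definition attach_prob C w := pr [pred s | attaches C s w].

Definition reach_prob C w := pr [pred s | reaches C s w].

Lemma attach_prob_ge0 C w : 0 <= attach_prob C w.
Proof. exact: pr_ge0. Qed.

Lemma reach_prob_ge0 C w : 0 <= reach_prob C w.
Proof. exact: pr_ge0. Qed.

Lemma attach_prob_le C w : attach_prob C w <= / INR 'C(n, #|w|).
Proof. by rewrite -pr_passes; apply: pr_le => s /andP[/andP[]]. Qed.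

Lemma pr_reaches_passes C y x : x \subset y ->
  pr [pred s | reaches C s y && passes s x] = reach_prob C y / INR 'C(#|y|, #|x|).
Proof.
move=> xy; have := @pr_passes_sub n (fun s => avoids C s (n - #|y|)%N) y x.
rewrite -[pr [pred s | _ && passes s y]]/(reach_prob C y) => <- //.
  by rewrite /pr; congr (_ * INR _); apply: eq_card => s; rewrite !inE andbA.
by move=> s a b; apply: avoids_tperm.
Qed.

Definition occupied_below C y := #|[set a in y | y :\ a \in C]|.

Definition unoccupied_below C y := #|[set a in y | y :\ a \notin C]|.

Lemma occupied_belowD C y :
  (occupied_below C y + unoccupied_below C y = #|y|)%N.
Proof.
rewrite /occupied_below /unoccupied_below -(cardsID [set a | y :\ a \in C] y).
by congr (_ + _)%N; apply: eq_card => a; rewrite !inE // andbC.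
Qed.

(** From [y] the walk moves to each lower neighbour with probability [1 / #|y|], and these events
    are disjoint. *)
Lemma attach_prob_ge C y : (0 < #|y|)%N ->
  reach_prob C y * INR (occupied_below C y) / INR #|y| <= attach_prob C y.
Proof.
move=> y0.
have cardD a : a \in y -> #|y :\ a| = #|y|.-1.
  by move=> ay; have := cardsD1 a y; rewrite ay => ->.
have -> : reach_prob C y * INR (occupied_below C y) / INR #|y| =
    \big[Rplus/0]_(a in [set a in y | y :\ a \in C])
       pr [pred s | reaches C s y && passes s (y :\ a)].
  rewrite (eq_bigr (fun=> reach_prob C y / INR #|y|)) ?rsum_const_set.
    by rewrite /occupied_below /Rdiv; lra.
  move=> a; rewrite inE => /andP[ay _]; rewrite pr_reaches_passes ?subsetDl //.
  by rewrite cardD // -bin_sub ?leq_pred // -subn1 subKn ?bin1.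
under eq_bigr do rewrite prE.
rewrite -rsum_mull exchange_big /= /attach_prob prE; apply: Rmult_le_compat_l.
  exact/Rlt_le/Rinv_0_lt_compat/fact_gt0R.
apply: rsum_le => s _.
case: (pickP [pred a | [&& a \in y, y :\ a \in C, reaches C s y & passes s (y :\ a)]]).
  move=> b /and4P[/= bin bC br bp]; rewrite (bigD1 b) ?inE ?bin //= big1 => [|a].
    have -> : attaches C s y.
      rewrite /attaches br; move/eqP: bp; rewrite cardD //.
      have -> : (n - #|y|.-1 = (n - #|y|).+1)%N by have := card_le_n y; lia.
      by move=> ->.
    by rewrite br bp /=; lra.
  rewrite inE => /andP[/andP[ay aC] ab]; rewrite br /= /passes cardD //.
  move/eqP: bp; rewrite cardD // => ->.
  case: eqP => // /setP/(_ a); rewrite !inE eqxx ay ab.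
  by [].
move=> none; rewrite big1 => [|a]; first exact: pos_INR.
rewrite inE => /andP[ay aC]; have := none a; rewrite inE ay aC /= => ->.
by [].
Qed.

(** A walk that attaches at [x] has just left an unoccupied upper neighbour [y], from which it
    chooses [x] with probability [1 / #|y|]. *)
Lemma attach_prob_le_above C x : (#|x| < n)%N ->
  attach_prob C x <=
  \big[Rplus/0]_(y | [&& y \notin C, #|y| == #|x|.+1 & x \subset y])
     (reach_prob C y / INR #|x|.+1).
Proof.
move=> xn.
rewrite (eq_bigr (fun y => pr [pred s | reaches C s y && passes s x])); last first.
  by move=> y /and3P[_ /eqP yx xy]; rewrite pr_reaches_passes // yx binSn.
apply: pr_union_le => s /andP[/andP[av px] nx].
set j := (n - #|x|.+1)%N; have jE : (n - #|x| = j.+1)%N by lia.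
have j_le : (j <= n - #|x|)%N by lia.
have cy : #|walk s j| = #|x|.+1 by rewrite card_walk; lia.
have sub : x \subset walk s j by move/eqP: px => {1}<-; apply: walk_sub.
exists (walk s j); first by rewrite cy eqxx sub !andbT; move/avoidsP: av; apply.
by rewrite /= px andbT /reaches cy -/j (avoidsW j_le av) /passes cy -/j eqxx.
Qed.

(** A walk through [z] fails to reach it only if it has passed an occupied [w] strictly above [z]; a
    union bound over [w] with [pr_passes2] gives the loss. *)
Lemma reach_prob_ge C z : z \notin C ->
  / INR 'C(n, #|z|) *
    (1 - \big[Rplus/0]_(w in C | z \proper w) / INR 'C(n - #|z|, #|w| - #|z|))
  <= reach_prob C z.
Proof.
move=> zC; rewrite Rmult_minus_distr_l Rmult_1_r rsum_mull -pr_passes.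
rewrite (eq_bigr (fun w => pr [pred s | passes s w && passes s z])); last first.
  move=> w /andP[_ /proper_sub zw]; by rewrite pr_passes2 // pr_passes Rinv_mult.
set S := \big[_/_]_(_ | _) _.
suff : pr [pred s | passes s z] <= reach_prob C z + S by lra.
have split (A B : pred 'S_n) : pr A <= pr B + pr [pred s | A s && ~~ B s].
  rewrite !prE -Rmult_plus_distr_l -big_split /=; apply: Rmult_le_compat_l.
    exact/Rlt_le/Rinv_0_lt_compat/fact_gt0R.
  by apply: rsum_le => s _; case: (A s); case: (B s) => /=; lra.
apply: Rle_trans (split _ [pred s | reaches C s z]) _.
apply: Rplus_le_compat_l; apply: pr_union_le => s /andP[/= pz].
rewrite /reaches pz andbT => /forallPn[i]; rewrite negbK => wC.
have i_le := leq_ord i; have i_n := leq_trans i_le (leq_subr _ _).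
exists (walk s i); last by rewrite /= andbT /passes walkK.
have := walk_sub s i_le; rewrite (eqP pz) wC properEneq => -> /=; rewrite andbT.
by apply: contraNneq zC => ->.
Qed.

(** A walk attaching on level [l.+1] has an occupied vertex as its visit to level [l], and it
    attaches at only one vertex. *)
Lemma sum_attach_prob_level C l : (l < n)%N ->
  \big[Rplus/0]_(w | (w \notin C) && (#|w| == l.+1)) attach_prob C w
  <= INR #|[set v in C | #|v| == l]| / INR 'C(n, l).
Proof.
move=> ln.
have -> : INR #|[set v in C | #|v| == l]| / INR 'C(n, l) =
    \big[Rplus/0]_(v in [set v in C | #|v| == l]) pr [pred s | passes s v].
  rewrite (eq_bigr (fun=> / INR 'C(n, l))) ?rsum_const_set // => v.
  by rewrite inE pr_passes => /andP[_ /eqP->].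
under eq_bigr do rewrite /attach_prob prE; under [X in _ <= X]eq_bigr do rewrite prE.
rewrite -!rsum_mull exchange_big [X in _ <= _ * X]exchange_big /=.
apply: Rmult_le_compat_l.
  exact/Rlt_le/Rinv_0_lt_compat/fact_gt0R.
apply: rsum_le => s _.
case: (pickP [pred w : {set 'I_n} | [&& w \notin C, #|w| == l.+1 & attaches C s w]]).
  move=> w /and3P[/= wC /eqP wl at_w].
  rewrite (bigD1 w) ?wC ?wl ?eqxx //= big1 => [|w' /andP[_ w'w]].
    rewrite at_w; set v := walk s (n - l)%N.
    have vl : #|v| = l by apply: card_walk_sub; lia.
    have vC : v \in C.
      case/andP: at_w => _; rewrite wl.
      by have -> : ((n - l.+1).+1 = n - l)%N by lia.
    rewrite (bigD1 v) ?inE ?vC ?vl //= /passes vl eqxx.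
    by apply/Rplus_le_compat_l/rsum_ge0 => i _; exact: pos_INR.
  case: (boolP (attaches C s w')) => // at_w'.
  by rewrite (attaches_uniq at_w at_w') eqxx in w'w.
move=> none; rewrite big1 => [|w]; first by apply: rsum_ge0 => v _; exact: pos_INR.
by move=> /andP[wC wl]; have := none w; rewrite inE /= wC wl /= => ->.
Qed.

(** The transition operator of the chain, acting on functions of the cluster. *)
Definition step (f : cluster n -> R) C : R :=
  / INR n`! * \big[Rplus/0]_s f (dla_step C s).

(** At most one vertex attaches under a given walk, so the expected increment is a sum over the
    vertices that may be added. After termination none attaches and the sum vanishes. *)
Lemma stepE f C : set0 \in C ->
  step f C = f C +
    \big[Rplus/0]_(w | w \notin C) (attach_prob C w * (f (w |: C) - f C)).
Proof.
move=> C0; rewrite /step.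
rewrite (eq_bigr (fun s => f C +
   \big[Rplus/0]_(w | w \notin C) (INR (attaches C s w) * (f (w |: C) - f C)))).
  rewrite big_split /= rsum_const Rmult_plus_distr_l card_Sn; congr (_ + _).
    by rewrite -Rmult_assoc Rinv_l ?Rmult_1_l //; have := fact_gt0R n; lra.
  rewrite exchange_big rsum_mull; apply: eq_bigr => w _.
  rewrite /attach_prob prE Rmult_assoc; congr (_ * _).
  by rewrite Rmult_comm rsum_mull; apply: eq_bigr => s _; rewrite Rmult_comm.
have aux (a b : R) : a = b + (1 * (a - b) + 0) by ring.
move=> s _; rewrite /dla_step; case: (new_vertexP s C0) => [[_ vC none]|at_v].
  rewrite big1 => [|w _]; last by rewrite (negbTE (none w)) Rmult_0_l.
  by rewrite Rplus_0_r (setUidPr _) // sub1set.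
have vC : new_vertex C s \notin C by case/andP: at_v => /reaches_notin.
rewrite (bigD1 (new_vertex C s)) //= at_v big1 => [|w /andP[_ wv]]; first exact: aux.
case: (boolP (attaches C s w)) => [at_w|_]; last by rewrite Rmult_0_l.
by rewrite (attaches_uniq at_v at_w) eqxx in wv.
Qed.

End Attachment.

(** * The Markov chain of clusters *)

Definition stable n (I : cluster n -> Prop) := forall C s, I C -> I (dla_step C s).

Lemma sub_dla_step n (C : cluster n) s : C \subset dla_step C s.
Proof. exact: subsetUr. Qed.

Lemma stable_rooted n : stable (fun C : cluster n => set0 \in C).
Proof. by move=> C s; apply/subsetP/sub_dla_step. Qed.
Arguments stable_rooted {n} C s _.

Lemma stableT n : stable (fun _ : cluster n => True).
Proof. by []. Qed.
Arguments stableT {n} C s _.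

Lemma stable_and n (I J : cluster n -> Prop) :
  stable I -> stable J -> stable (fun C => I C /\ J C).
Proof. by move=> sI sJ C s [/sI ? /sJ ?]. Qed.
Arguments stable_and {n I J} sI sJ C s _.

Section Iteration.
Variable n : nat.
Implicit Types (C : cluster n) (f g : cluster n -> R) (I : cluster n -> Prop).

(** The expectation of [f] after [t] steps, as a function of the initial cluster. *)
Definition run t f : cluster n -> R := iter t (@step n) f.

Lemma step_le I f g C : stable I -> (forall C, I C -> f C <= g C) -> I C ->
  step f C <= step g C.
Proof.
move=> sI fg IC; apply: Rmult_le_compat_l.
  exact/Rlt_le/Rinv_0_lt_compat/fact_gt0R.
by apply: rsum_le => s _; apply/fg/sI.
Qed.

Lemma run_le I f g C t : stable I -> (forall C, I C -> f C <= g C) -> I C ->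
  run t f C <= run t g C.
Proof.
move=> sI fg; elim: t C => [|t IH] C IC; first exact: fg.
exact: (step_le sI IH).
Qed.

Lemma run_leT t f g C : (forall C, f C <= g C) -> run t f C <= run t g C.
Proof. by move=> fg; apply: (@run_le _ _ _ _ _ stableT). Qed.

Lemma runD a b f C : run (a + b) f C = run a (run b f) C.
Proof. by rewrite /run iterD. Qed.

Lemma step_cst c C : step (fun=> c) C = c.
Proof.
rewrite /step rsum_const card_Sn -Rmult_assoc Rinv_l ?Rmult_1_l //.
by have := fact_gt0R n; lra.
Qed.

Lemma run_cst t c C : run t (fun=> c) C = c.
Proof.
elim: t C => // t IH C; rewrite -[RHS](step_cst c C).
by congr (_ * _); apply: eq_bigr => s _; apply: IH.
Qed.

Lemma step_scale c f C : step (fun C => c * f C) C = c * step f C.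
Proof. by rewrite /step -rsum_mull; ring. Qed.

Lemma run_scale t c f C : run t (fun C => c * f C) C = c * run t f C.
Proof.
elim: t C => // t IH C; rewrite -[RHS](step_scale c _ C).
by congr (_ * _); apply: eq_bigr => s _; apply: IH.
Qed.

Lemma step_add f g C : step (fun C => f C + g C) C = step f C + step g C.
Proof. by rewrite /step big_split Rmult_plus_distr_l. Qed.

Lemma run_add t f g C : run t (fun C => f C + g C) C = run t f C + run t g C.
Proof.
elim: t C => // t IH C; rewrite -[RHS](step_add _ _ C).
by congr (_ * _); apply: eq_bigr => s _; apply: IH.
Qed.

Lemma run_sum (T : Type) (r : seq T) (P : pred T) (F : T -> cluster n -> R) t C :
  run t (fun C => \big[Rplus/0]_(i <- r | P i) F i C) C =
  \big[Rplus/0]_(i <- r | P i) run t (F i) C.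
Proof.
have ext f g D : (forall D, f D = g D) -> run t f D = run t g D.
  by move=> fg; apply: Rle_antisym; apply: run_leT => E; rewrite fg; lra.
elim: r => [|i r IH].
  by rewrite big_nil -[RHS](run_cst t 0 C); apply: ext => D; rewrite big_nil.
rewrite big_cons; case Pi: (P i); last first.
  by rewrite -IH; apply: ext => D; rewrite big_cons Pi.
by rewrite -IH -run_add; apply: ext => D; rewrite big_cons Pi.
Qed.

Lemma run_ge0 t f C : (forall C, 0 <= f C) -> 0 <= run t f C.
Proof. by move=> f0; rewrite -(run_cst t 0 C); apply: run_leT. Qed.

(** The one-step inequality is asked only under a stable property, so that it may use facts such as
    [good] that hold from some time on. *)
Lemma run_supermartingale I q f C t : stable I -> 0 <= q ->
  (forall C, I C -> step f C <= q * f C) -> I C -> run t f C <= q ^ t * f C.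
Proof.
move=> sI q0 fq; elim: t C => [|t IH] C IC; first by rewrite /=; lra.
apply: Rle_trans (step_le sI IH IC) _; rewrite step_scale /=.
apply: Rle_trans (Rmult_le_compat_l _ _ _ (pow_le q t q0) (fq C IC)) _.
by rewrite -Rmult_assoc [_ ^ _ * q]Rmult_comm; apply: Rle_refl.
Qed.

Lemma run_increasing a b f C : (forall C s, f C <= f (dla_step C s)) ->
  (a <= b)%N -> run a f C <= run b f C.
Proof.
move=> f_incr ab; rewrite -(subnKC ab) runD; apply: run_leT => D.
elim: (b - a)%N D => [|j IH] D; first by rewrite /=; lra.
apply: Rle_trans (IH D) _; rewrite -addn1 runD; apply: run_leT => E.
by rewrite -{1}(step_cst (f E) E); apply: Rmult_le_compat_l;
  [exact/Rlt_le/Rinv_0_lt_compat/fact_gt0R | apply: rsum_le => s _].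
Qed.

Lemma dla_step_end C s : setT \in C -> dla_step C s = C.
Proof.
move=> CT; rewrite /dla_step /new_vertex /first_hit /= walk0 CT /= walk0.
by apply/setUidPr; rewrite sub1set.
Qed.

(** Once [setT] is occupied the cluster is frozen, so stopping there and running for all [t] steps
    give the same value. *)
Lemma reachE t C E :
  reach t C E = run t (fun C => if setT \in C then indic E C else 0) C.
Proof.
elim: t C => [|t IH] C /=; first by case: ifP.
case: ifP => CT; last by congr (_ * _); apply: eq_bigr => s _; apply: IH.
rewrite -[LHS](step_cst _ C); congr (_ * _); apply: eq_bigr => s _.
by rewrite dla_step_end // -IH; case: (t) => /=; rewrite CT.
Qed.

(** Each step before termination enlarges the cluster, which has at most [2 ^ n] vertices; a full
    cluster contains [setT]. *)
Lemma run_terminates t C : set0 \in C -> (2 ^ n <= #|C| + t)%N ->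
  run t (fun C => if setT \in C then 0 else 1) C = 0.
Proof.
elim: t C => [|t IH] C C0 le_t.
  rewrite /=; case: ifP => // /negP[].
  suff -> : C = setT by rewrite in_setT.
  apply/eqP; rewrite eqEcard subsetT.
  have -> : [set: {set 'I_n}] = powerset [set: 'I_n].
    by apply/setP => z; rewrite powersetE subsetT inE.
  by rewrite card_powerset cardsT card_ord; rewrite addn0 in le_t.
have [CT|CT] := boolP (setT \in C).
  have runT u : run u (fun C => if setT \in C then 0 else 1) C = 0.
    elim: u => [|u IHu]; first by rewrite /= CT.
    rewrite -[RHS](step_cst 0 C); congr (_ * _); apply: eq_bigr => s _.
    by rewrite dla_step_end.
  exact: runT.
rewrite -[RHS](step_cst 0 C); congr (_ * _); apply: eq_bigr => s _.
apply: IH; first exact: stable_rooted.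
case: (new_vertexP s C0) => [[vT]|/andP[/reaches_notin vC _]].
  by rewrite vT in CT.
by rewrite /dla_step cardsU1 vC; lia.
Qed.

End Iteration.

(** * Growth above a level and blocking *)

Definition start n : cluster n := [set set0].
Arguments start {n}.

Section Levels.
Variable n : nat.
Implicit Types (C : cluster n) (w x y z v : {set 'I_n}).

Lemma start_rooted : set0 \in (start : cluster n).
Proof. by rewrite inE. Qed.

Definition level_size C l := #|[set v in C | #|v| == l]|.

Lemma card_filter_insert C w (P : pred {set 'I_n}) : w \notin C ->
  #|[set v in w |: C | P v]| = (P w + #|[set v in C | P v]|)%N.
Proof.
move=> wC; case Pw: (P w).
  have -> : [set v in w |: C | P v] = w |: [set v in C | P v].
    by apply/setP => v; rewrite !inE; case: eqP => [->|//]; rewrite Pw.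
  by rewrite cardsU1 !inE (negbTE wC).
congr #|pred_of_set _|; apply/setP => v; rewrite !inE.
by case: eqP => [->|//]; rewrite Pw (negbTE wC).
Qed.

Lemma level_size_le C l : (level_size C l <= 'C(n, l))%N.
Proof.
have := card_draws 'I_n l; rewrite card_ord => <-.
by apply: subset_leq_card; apply/subsetP => v; rewrite !inE => /andP[].
Qed.

Lemma step_level_size C l : set0 \in C -> (l < n)%N ->
  step (fun C => INR (level_size C l.+1)) C <=
  INR (level_size C l.+1) + INR (level_size C l) / INR 'C(n, l).
Proof.
move=> C0 ln; rewrite stepE //; apply: Rplus_le_compat_l.
apply: Rle_trans _ (sum_attach_prob_level C ln).
rewrite [X in _ <= X]big_mkcondr; apply: rsum_le => w wC.
rewrite /level_size card_filter_insert // INRD.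
have := attach_prob_ge0 C w.
by case: (#|w| == l.+1) => /=; lra.
Qed.

(** Level [l] only fills up, so its expected size at time [t] bounds the growth rate of level [l.+1]
    at all earlier steps. *)
Lemma run_level_size_rec t l : (l < n)%N ->
  run t (fun C => INR (level_size C l.+1)) start <=
  INR t * run t (fun C => INR (level_size C l)) start / INR 'C(n, l).
Proof.
move=> ln; have b0 : 0 < INR 'C(n, l) by apply: bin_gt0R; lia.
elim: t => [|t IH].
  rewrite /= /level_size.
  have -> : [set v in (start : cluster n) | #|v| == l.+1] = set0.
    by apply/setP => v; rewrite !inE; case: eqP => // ->; rewrite cards0.
  by rewrite cards0 /=; lra.
set r := run t (fun C => INR (level_size C l)) start in IH *.
have r_le : r <= run t.+1 (fun C => INR (level_size C l)) start.
  apply: run_increasing => // C s; apply/leq_INR/subset_leq_card/subsetP => v.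
  by rewrite !inE => /andP[vC ->]; rewrite vC orbT.
have r0 : 0 <= r by apply: run_ge0 => C; apply: pos_INR.
apply: Rle_trans (_ : (INR t + 1) * r / INR 'C(n, l) <= _); last first.
  rewrite S_INR; apply: Rmult_le_compat_r; first exact/Rlt_le/Rinv_0_lt_compat.
  by apply: Rmult_le_compat_l => //; have := pos_INR t; lra.
rewrite -addn1 runD.
apply: Rle_trans (_ : run t (fun C => INR (level_size C l.+1) +
    / INR 'C(n, l) * INR (level_size C l)) start <= _).
  apply: (@run_le _ (fun C => set0 \in C)); [exact: stable_rooted| |exact: start_rooted].
  by move=> C C0; rewrite [/ _ * _]Rmult_comm; apply: step_level_size.
rewrite run_add run_scale -/r.
by apply: Rle_trans (Rplus_le_compat_r _ _ _ IH) _; rewrite /Rdiv; lra.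
Qed.

(** Iterating the recursion, each level above [L] contributes a factor [t / C(n, l) <= 1 / D]; level
    [L] itself is bounded by its full size. *)
Lemma run_level_size_geom t L j (D : R) : 0 < D -> (L + j <= n)%N ->
  (forall l, (L <= l < L + j)%N -> INR t * D <= INR 'C(n, l)) ->
  run t (fun C => INR (level_size C (L + j)%N)) start <= INR 'C(n, L) * (/ D) ^ j.
Proof.
move=> D0; elim: j => [|j IH] Ljn tD.
  rewrite addn0 /= Rmult_1_r -[X in _ <= X](@run_cst n t _ start).
  by apply: run_leT => C; apply/leq_INR/level_size_le.
rewrite addnS; apply: Rle_trans (run_level_size_rec _ _) _; first by lia.
have {}IH : run t (fun C => INR (level_size C (L + j)%N)) start <= INR 'C(n, L) * (/ D) ^ j.
  by apply: IH => [|l ll]; [lia | apply: tD; lia].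
have tD' : INR t * D <= INR 'C(n, L + j) by apply: tD; lia.
have b0 : 0 < INR 'C(n, L + j) by apply: bin_gt0R; lia.
set r := run _ _ _ in IH *.
have r0 : 0 <= r by apply: run_ge0 => C; apply: pos_INR.
have tb : INR t / INR 'C(n, L + j) <= / D.
  apply: (Rmult_le_reg_r (INR 'C(n, L + j))) => //.
  apply: (Rmult_le_reg_r D) => //.
  have -> : INR t / INR 'C(n, L + j) * INR 'C(n, L + j) * D = INR t * D by field; lra.
  by have -> : / D * INR 'C(n, L + j) * D = INR 'C(n, L + j) by [field; lra].
have -> : INR t * r / INR 'C(n, L + j) = INR t / INR 'C(n, L + j) * r by rewrite /Rdiv; ring.
apply: Rle_trans (Rmult_le_compat_r _ _ _ r0 tb) _.
have D0' := Rinv_0_lt_compat _ D0.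
apply: Rle_trans (Rmult_le_compat_l _ _ _ (Rlt_le _ _ D0') IH) _.
by rewrite /=; lra.
Qed.

Lemma card_supersets z j : (#|z| <= j <= n)%N ->
  #|[set w : {set 'I_n} | (z \subset w) && (#|w| == j)]| = 'C(n - #|z|, j - #|z|).
Proof.
move=> /andP[zj jn].
have aux a : (n - j + a = n)%N -> a = j by lia.
have -> : [set w : {set 'I_n} | (z \subset w) && (#|w| == j)] =
    (@setC _) @: [set w : {set 'I_n} | (w \subset ~: z) & (#|w| == (n - j)%N)].
  apply/setP => w; apply/idP/imsetP; rewrite ?inE.
    move=> /andP[zw /eqP wj]; exists (~: w); rewrite ?setCK // inE setCS zw.
    by have := cardsC w; rewrite card_ord wj => wC; apply/eqP; lia.
  case=> v; rewrite inE => /andP[vz /eqP vj] ->; rewrite -setCS setCK vz /=.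
  by have := cardsC v; rewrite card_ord vj => vC; apply/eqP/aux.
rewrite card_imset; last exact: can_inj (@setCK _).
rewrite cards_draws; have := cardsC z; rewrite card_ord => zE.
have -> : #|~: z| = (n - #|z|)%N by lia.
by rewrite -bin_sub; [congr 'C(_, _); lia | lia].
Qed.

End Levels.

Lemma leq_bin_self m j : (0 < j < m)%N -> (m <= 'C(m, j))%N.
Proof.
elim: m j => [|m IH] [|j] //=; rewrite ltnS => jm.
rewrite binS; have [jm1|] := ltnP j.+1 m.
  have := IH j.+1 jm1; have : (0 < 'C(m, j))%N by rewrite bin_gt0; lia.
  by lia.
move=> mj; have -> : m = j.+1 by lia.
by rewrite binn binSn.
Qed.

Lemma exp_sub1_le x : 0 <= x <= 1 / 2 -> exp x - 1 <= 2 * x.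
Proof.
move=> [x0 x1]; have e1 := exp_ineq1_le (- x); have e0 := exp_pos x.
have e2 : exp x * exp (- x) = 1 by rewrite -exp_plus Rplus_opp_r exp_0.
nra.
Qed.

Section Blocking.
Variables (n : nat) (h : nat).
Implicit Types (C : cluster n) (w x y z v : {set 'I_n}).

(** A union bound for the probability that a walk through [z] has met an occupied vertex above [z],
    restricted to levels below [h]. *)
Definition blocking z C : R :=
  \big[Rplus/0]_(w in C | (z \proper w) && (#|w| < h)%N)
     / INR 'C(n - #|z|, #|w| - #|z|).

Lemma blocking_insert z C w : w \notin C ->
  blocking z (w |: C) = blocking z C +
    (if (z \proper w) && (#|w| < h)%N then / INR 'C(n - #|z|, #|w| - #|z|) else 0).
Proof.
move=> wC; rewrite /blocking Rplus_comm.
rewrite big_mkcondr /= big_setU1 //=; congr (_ + _).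
by rewrite [RHS]big_mkcondr.
Qed.

(** Up to level [n / 3] each binomial coefficient is at least twice the preceding one, so the sum is
    dominated by a geometric series. *)
Lemma sum_inv_bin_le i l : (3 * (i + l) <= n)%N ->
  \big[Rplus/0]_(j < l) / INR 'C(n, i + j) <= 2 / INR 'C(n, i).
Proof.
elim: l i => [|l IH] i il.
  rewrite big_ord0; apply: Rmult_le_pos; first lra.
  by apply/Rlt_le/Rinv_0_lt_compat/bin_gt0R; lia.
rewrite big_ord_recl /= addn0.
under eq_bigr do rewrite /bump /= add1n addnS -addSn.
have b0 : 0 < INR 'C(n, i) by apply: bin_gt0R; lia.
case: (posnP l) => [->|l0].
  rewrite big_ord0 /Rdiv; have := Rinv_0_lt_compat _ b0; lra.
have b1 : 0 < INR 'C(n, i.+1) by apply: bin_gt0R; lia.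
apply: Rle_trans (Rplus_le_compat_l _ _ _ (IH i.+1 _)) _; first by lia.
have le2 : 2 * INR 'C(n, i) <= INR 'C(n, i.+1).
  rewrite -[2]/(INR 2) -INRM; apply: leq_INR.
  by have := mul_bin_left n i; nia.
have : / INR 'C(n, i.+1) <= / (2 * INR 'C(n, i)) by apply: Rinv_le_contravar; lra.
by rewrite Rinv_mult /Rdiv; have := Rinv_0_lt_compat _ b0; lra.
Qed.

(** On one level above [z], the number of possible [w] cancels the increment
    [1 / C(n - #|z|, #|w| - #|z|)] that each causes. What remains is the sum of the attachment
    bounds [1 / C(n, j)] over levels [j], at most [2 / C(n, #|z| + 1)]; another factor 2 comes from
    [exp_sub1_le]. *)
Lemma step_exp_blocking z C lam : set0 \in C -> (3 * h <= n)%N -> (#|z| < h)%N ->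
  0 <= lam -> 2 * lam <= INR (n - #|z|) ->
  step (fun C => exp (lam * blocking z C)) C <=
  exp (4 * lam / INR 'C(n, #|z|.+1)) * exp (lam * blocking z C).
Proof.
move=> C0 hn zh lam0 lam_le; rewrite stepE //.
set e := exp (lam * blocking z C).
have e0 : 0 < e by apply: exp_pos.
set S := \big[_/_]_(_ | _) _.
suff S_le : S <= e * (4 * lam / INR 'C(n, #|z|.+1)).
  have := exp_ineq1_le (4 * lam / INR 'C(n, #|z|.+1)); nra.
apply: (@Rle_trans _ (\big[Rplus/0]_(w : {set 'I_n} | (z \proper w) && (#|w| < h)%N)
   (e * (2 * lam) * (/ INR 'C(n, #|w|) * / INR 'C(n - #|z|, #|w| - #|z|)))) _).
  apply: (@Rle_trans _ (\big[Rplus/0]_(w : {set 'I_n} | (w \notin C) && ((z \proper w) &&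
    (#|w| < h)%N))
   (e * (2 * lam) * (/ INR 'C(n, #|w|) * / INR 'C(n - #|z|, #|w| - #|z|)))) _).
    rewrite /S [X in _ <= X]big_mkcondr; apply: rsum_le => w wC.
    rewrite blocking_insert //; case: ifP => [/andP[zw wh]|_]; last first.
      by rewrite Rplus_0_r; rewrite /e; lra.
    have zw' := proper_card zw; have wn := card_le_n w.
    set N := INR 'C(n - #|z|, #|w| - #|z|).
    (* The lower index lies strictly between [0] and [n - #|z|]. Hence [lam / N <= 1 / 2], as the
       linear bound on the exponential requires. *)
    have N_ge : INR (n - #|z|) <= N.
      by apply/leq_INR/leq_bin_self; lia.
    have nz : 0 < INR (n - #|z|) by apply: INR_gt0; lia.
    have N0 : 0 < N by lra.
    have xE : exp (lam * (blocking z C + / N)) - e = e * (exp (lam * / N) - 1).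
      by rewrite Rmult_plus_distr_l exp_plus -/e; ring.
    rewrite xE.
    have lN : 0 <= lam * / N <= 1 / 2.
      split; first by apply: Rmult_le_pos => //; apply/Rlt_le/Rinv_0_lt_compat.
      apply: (Rmult_le_reg_r N) => //.
      have -> : lam * / N * N = lam by field; lra.
      by lra.
    have := exp_sub1_le lN; have := attach_prob_le C w; have := attach_prob_ge0 C w.
    have := exp_ineq1_le (lam * / N).
    set p := attach_prob C w; set E := exp _; set b := / INR 'C(n, #|w|).
    move=> E1 p0 pb E2.
    have E3 : 0 <= e * (E - 1) by apply: Rmult_le_pos; lra.
    apply: Rle_trans (Rmult_le_compat_r _ _ _ E3 pb) _.
    have -> : e * (2 * lam) * (b * / N) = b * (e * (2 * (lam * / N))) by ring.
    apply: Rmult_le_compat_l; first by lra.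
    by apply: Rmult_le_compat_l; lra.
  apply: rsum_subset_le => [w /andP[]//|w /andP[zw wh]].
  have zw' := proper_card zw; have wn := card_le_n w.
  apply: Rmult_le_pos; first by apply: Rmult_le_pos; lra.
  by apply: Rmult_le_pos; apply/Rlt_le/Rinv_0_lt_compat/bin_gt0R; lia.
rewrite -rsum_mull.
have -> : e * (4 * lam / INR 'C(n, #|z|.+1)) = e * (2 * lam) * (2 / INR 'C(n, #|z|.+1)).
  by rewrite /Rdiv; ring.
apply: Rmult_le_compat_l; first by apply: Rmult_le_pos; lra.
apply: Rle_trans _ (sum_inv_bin_le (i := #|z|.+1) (l := h - #|z|.+1) _); last by lia.
(* Sort the vertices by level: [j] stands for level [#|z| + 1 + j]. *)
rewrite (eq_bigr (fun w : {set 'I_n} => \big[Rplus/0]_(j < h - #|z|.+1 | #|w| == (#|z|.+1 +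
  j)%N)
  (/ INR 'C(n, #|z|.+1 + j) * / INR 'C(n - #|z|, j.+1)))); last first.
  move=> w /andP[zw wh]; have zw' := proper_card zw.
  have lt_j : (#|w| - #|z|.+1 < h - #|z|.+1)%N by lia.
  rewrite (big_pred1 (Ordinal lt_j)) /= => [|j]; last first.
    by rewrite /= -val_eqE /=; apply/eqP/eqP => ->; rewrite ?addKn ?subnKC.
  by rewrite subnKC // -subSn.
rewrite (exchange_big_dep predT) //=; apply: rsum_le => j _.
have lt_j := ltn_ord j.
apply: (@Rle_trans _ (INR 'C(n - #|z|, j.+1) *
    (/ INR 'C(n, #|z|.+1 + j) * / INR 'C(n - #|z|, j.+1))) _); last first.
  have b0 : 0 < INR 'C(n - #|z|, j.+1) by apply: bin_gt0R; lia.
  have aux (a b : R) : 0 < a -> a * (b * / a) = b by move=> ?; field; lra.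
  by right; apply: aux.
rewrite rsum_const; apply: Rmult_le_compat_r.
  by apply: Rmult_le_pos; apply/Rlt_le/Rinv_0_lt_compat/bin_gt0R; lia.
apply: leq_INR.
have := @card_supersets n z (#|z|.+1 + j); have -> : (#|z|.+1 + j - #|z| = j.+1)%N by lia.
move=> <-; last by lia.
apply: subset_leq_card; apply/subsetP => w; rewrite !inE unfold_in.
by move=> /andP[/andP[/proper_sub -> _] ->].
Qed.

End Blocking.

(** * Filling a level *)

Definition good n i (C : cluster n) :=
  forall y : {set 'I_n}, #|y| = i -> (20 * unoccupied_below C y <= i)%N.

Definition connected n (C : cluster n) :=
  forall v : {set 'I_n}, v \in C -> v != set0 -> exists2 a, a \in v & v :\ a \in C.

(** The second clause makes [blocking h] count every occupied vertex above [z]. *)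
Definition unblocked n h i (C : cluster n) :=
  (forall z : {set 'I_n}, #|z| = i -> blocking h z C <= 1 / 2) /\
  (forall v : {set 'I_n}, v \in C -> (#|v| < h)%N).

Lemma stable_good n i : stable (@good n i).
Proof.
move=> C s gC y yi; apply: leq_trans (gC y yi); rewrite leq_mul2l /=.
apply/subset_leq_card/subsetP => a; rewrite !inE => /andP[-> aC] /=.
by apply: contraNN aC => aC; rewrite aC orbT.
Qed.

(** A new vertex has the next vertex of its walk, which is occupied, as a lower neighbour. The root
    belongs to the invariant because [new_vertexP] needs it. *)
Lemma stable_connected n : stable (fun C : cluster n => set0 \in C /\ connected C).
Proof.
move=> C s [C0 conn]; split; first exact: stable_rooted.
move=> v; rewrite in_setU1; have sub a : v :\ a \in C -> v :\ a \in dla_step C s.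
  by move=> vC; apply: (subsetP (sub_dla_step C s)).
case: (boolP (v \in C)) => [vC _ v0|vC].
  by have [a av /sub] := conn v vC v0; exists a.
rewrite orbF => /eqP vE v0; case: (new_vertexP s C0) => [[_]|].
  by rewrite -vE (negbTE vC).
rewrite -vE => /andP[/andP[_ /eqP pv]]; set j := (n - #|v|)%N => jC.
have vn := card_le_n v; have v_gt0 : (0 < #|v|)%N by rewrite card_gt0.
have cj : #|walk s j.+1| = #|v|.-1 by rewrite card_walk /j; lia.
have subj : walk s j.+1 \subset v by rewrite -pv -/j; apply: walk_sub.
have /card_gt0P[a] : (0 < #|v :\: walk s j.+1|)%N.
  by have := cardsID (walk s j.+1) v; rewrite (setIidPr subj) cj; lia.
rewrite inE => /andP[aj av]; exists a => //; apply: sub.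
suff -> : v :\ a = walk s j.+1 by [].
apply/esym/eqP; rewrite eqEcard subsetD1 subj aj cj /=.
have aux p q : (p = 1 + q)%N -> (q <= p.-1)%N by lia.
by apply: aux; have := cardsD1 a v; rewrite av.
Qed.

(** Descending through occupied lower neighbours meets every level. So if level [h] is empty,
    nothing above it is occupied. *)
Lemma connected_level n (C : cluster n) (v : {set 'I_n}) h :
  connected C -> v \in C -> (h <= #|v|)%N -> (0 < level_size C h)%N.
Proof.
move=> conn; have [d] := ubnP (#|v|)%N; elim: d v => // d IH v vd vC hv.
have [vh|vh] := eqVneq #|v| h.
  by apply/card_gt0P; exists v; rewrite inE vC vh eqxx.
have [a av vaC] : exists2 a, a \in v & v :\ a \in C.
  by apply: conn => //; rewrite -card_gt0; lia.
by have := cardsD1 a v; rewrite av => cE; apply: IH vaC _; lia.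
Qed.

Lemma INR_20 : INR 20 = 20.
Proof. by rewrite INR_IZR_INZ. Qed.

Section Phase1.
Variables (n h i : nat).
Hypotheses (i0 : (0 < i)%N) (i_n : (i < n)%N).
Implicit Types (C : cluster n) (w x y z v A : {set 'I_n}).

(** By [unblocked], at least half of the walks through [z] reach it; by [good], the next vertex is
    then occupied with probability at least [19 / 20]. *)
Lemma attach_prob_unblocked C z : good i C -> unblocked h i C ->
  #|z| = i -> z \notin C -> 19 / 40 * / INR 'C(n, i) <= attach_prob C z.
Proof.
move=> gC [blk lt_h] zi zC.
have z0 : (0 < #|z|)%N by rewrite zi.
apply: Rle_trans _ (attach_prob_ge C z0).
have := reach_prob_ge zC; have := blk z zi; rewrite /blocking.
have -> : \big[Rplus/0]_(w in C | z \proper w) / INR 'C(n - #|z|, #|w| - #|z|) =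
  \big[Rplus/0]_(w in C | (z \proper w) && (#|w| < h)%N) / INR 'C(n - #|z|, #|w| - #|z|).
  by apply: eq_bigl => w; case wC: (w \in C); rewrite //= lt_h ?andbT.
set b := \big[_/_]_(_ in _ | _) _; set q := reach_prob C z.
rewrite zi; set c := / INR 'C(n, i) => b_le q_ge.
have c0 : 0 < c by apply/Rinv_0_lt_compat/bin_gt0R/ltnW.
have q_ge' : c / 2 <= q by nra.
have iR : 0 < INR i by apply: INR_gt0.
have occ : 19 / 20 * INR i <= INR (occupied_below C z).
  have := occupied_belowD C z; have := gC z zi; rewrite zi => /leq_INR; rewrite INRM INR_20.
  by move=> ? /(congr1 INR); rewrite INRD; lra.
have : 19 / 20 <= INR (occupied_below C z) / INR i.
  exact: Rle_divr.
have -> : q * INR (occupied_below C z) / INR i =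
  q * (INR (occupied_below C z) / INR i) by rewrite /Rdiv Rmult_assoc.
set o := _ / INR i; move=> o_ge.
by have : c / 2 * (19 / 20) <= q * o by [apply: Rmult_le_compat; lra]; lra.
Qed.

(** With [unblocked] included, the event can only be lost as the cluster grows, and while it holds
    the vertices [y :\ a] are attached at a known rate. *)
Definition survivors y A C :=
  (forall a, a \in A -> y :\ a \notin C) /\ unblocked h i C.

Lemma unblockedS C w : w \notin C -> unblocked h i (w |: C) -> unblocked h i C.
Proof.
move=> wC [blk lt_h]; split=> [z zi|v vC]; last by apply: lt_h; rewrite inE vC orbT.
have := blk z zi; rewrite blocking_insert //; case: ifP => [_|_]; last by lra.
have : 0 < INR 'C(n - #|z|, #|w| - #|z|).
  by apply: bin_gt0R; rewrite leq_sub2r ?card_le_n.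
by move/Rinv_0_lt_compat; lra.
Qed.

Lemma survivorsS y A C w : w \notin C -> survivors y A (w |: C) -> survivors y A C.
Proof.
move=> wC [yA] /unblockedS-/(_ wC) ub; split=> // a /yA.
by rewrite in_setU1 negb_or => /andP[].
Qed.

(** Attaching at any of the [#|A|] distinct vertices [y :\ a] destroys the event, and a lost event
    never returns. The rate is at least [(i + 1) / 20 * 19 / 40] over [C(n, i)], and [19 / 800]
    exceeds [1 / 50]. *)
Lemma step_survivors y A C : set0 \in C -> good i C -> #|y| = i.+1 -> A \subset y ->
  (i.+1 <= 20 * #|A|)%N ->
  step (indic (survivors y A)) C <=
  (1 - INR i.+1 / (50 * INR 'C(n, i))) * indic (survivors y A) C.
Proof.
move=> C0 gC yi Ay Ai; rewrite stepE //.
have [sC|nsC] := classic (survivors y A C); last first.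
  rewrite indicF // Rmult_0_r Rplus_0_l big1 => [|w wC]; first by lra.
  by rewrite indicF ?Rminus_diag ?Rmult_0_r // => /survivorsS-/(_ wC).
rewrite indicT //; set S := \big[_/_]_(_ | _) _.
have ub := sC.2.
have c0 := Rinv_0_lt_compat _ (bin_gt0R (ltnW i_n)).
suff : S <= - (INR #|A| * (19 / 40 * / INR 'C(n, i))).
  have : INR i.+1 <= 20 * INR #|A|.
    by have := leq_INR Ai; rewrite INRM INR_20; lra.
  have -> : INR i.+1 / (50 * INR 'C(n, i)) = INR i.+1 * / INR 'C(n, i) / 50.
    by rewrite /Rdiv Rinv_mult; ring.
  set c := / INR 'C(n, i) in c0 *; set u := INR i.+1; set a := INR #|A| => ua.
  have h1 : 0 <= (20 * a - u) * c by apply: Rmult_le_pos; lra.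
  have h2 : 0 <= u * c by apply: Rmult_le_pos; [apply: pos_INR | lra].
  by lra.
have inj : {in A &, injective (fun a => y :\ a)}.
  move=> a b aA bA /setP/(_ a); rewrite !inE eqxx (subsetP Ay) // andbT.
  by case: eqP.
apply: (@Rle_trans _ (\big[Rplus/0]_(w in [set y :\ a | a in A]) - attach_prob C w)).
  rewrite /S big_mkcond [X in _ <= X]big_mkcond /=; apply: rsum_le => w _.
  have p0 := attach_prob_ge0 C w.
  case: imsetP => [[a aA wE]|_].
    have wC : w \notin C by rewrite wE; apply: sC.1.
    rewrite wC indicF; first by lra.
    by move=> [/(_ a aA)]; rewrite wE in_setU1 eqxx.
  case: ifP => wC; last by lra.
  have aux (p x : R) : 0 <= p -> x <= 1 -> p * (x - 1) <= 0 by nra.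
  by apply: aux => //; apply: indic_le1.
have -> : - (INR #|A| * (19 / 40 * / INR 'C(n, i))) =
   \big[Rplus/0]_(a in A) (- (19 / 40 * / INR 'C(n, i))).
  by rewrite rsum_const_set; ring.
rewrite big_imset //=.
apply: rsum_le => a aA; apply: Ropp_le_contravar.
apply: attach_prob_unblocked => //; last exact: sC.1.
by have := cardsD1 a y; rewrite (subsetP Ay) // yi => -[].
Qed.

Lemma not_good_survivors C : ~ good i.+1 C -> unblocked h i C ->
  exists2 p : {set 'I_n} * {set 'I_n},
    [&& #|p.1| == i.+1, p.2 \subset p.1 & (i.+1 <= 20 * #|p.2|)%N] &
    survivors p.1 p.2 C.
Proof.
move=> ngC ub; apply: NNPP => none; apply: ngC => y yi.
rewrite leqNgt; apply/negP => lt_y; apply: none.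
exists (y, [set a in y | y :\ a \notin C]).
  rewrite /= yi eqxx ltnW //= andbT; apply/subsetP => a; rewrite inE.
  by case/andP.
by split=> // a; rewrite inE => /andP[].
Qed.

Lemma card_survivor_pairs :
  (#|[pred p : {set 'I_n} * {set 'I_n} |
     [&& #|p.1| == i.+1, p.2 \subset p.1 & (i.+1 <= 20 * #|p.2|)%N]]|
   <= 'C(n, i.+1) * 2 ^ i.+1)%N.
Proof.
apply: (@leq_trans #|[pred p : {set 'I_n} * {set 'I_n} |
     (#|p.1| == i.+1) && (p.2 \subset p.1)]|).
  by apply: subset_leq_card; apply/subsetP => p; rewrite !inE => /and3P[-> ->].
rewrite -sum1_card.
rewrite (eq_bigl (fun p : {set 'I_n} * {set 'I_n} => (#|p.1| == i.+1) && (p.2 \subset p.1))) //.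
rewrite -(pair_big_dep (fun y : {set 'I_n} => #|y| == i.+1)
   (fun y A : {set 'I_n} => A \subset y) (fun _ _ => 1%N)) /=.
rewrite (eq_bigr (fun=> 2 ^ i.+1)%N) => [|y /eqP yi].
  rewrite sum_nat_const leq_mul2r; apply/orP; right.
  have := card_draws 'I_n i.+1; rewrite card_ord => <-.
  by apply/eq_leq/eq_card => y; rewrite !inE.
by rewrite sum1_card -yi -card_powerset; apply: eq_card => A; rewrite !inE.
Qed.

(** If [good i] holds at time [t] and [unblocked] at time [t + w], a failure of [good i.+1] leaves a
    pair [(y, A)] that has survived the last [w] steps. The middle term is the union bound over
    these pairs. *)
Lemma run_not_good t (w : nat) :
  run (t + w) (indic (fun C => ~ good i.+1 C)) start <=
  run t (indic (fun C => ~ good i C)) start +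
  INR 'C(n, i.+1) * 2 ^ i.+1 * (1 - INR i.+1 / (50 * INR 'C(n, i))) ^ w +
  run (t + w) (indic (fun C => ~ unblocked h i C)) start.
Proof.
set q := 1 - _.
pose P := [pred p : {set 'I_n} * {set 'I_n} |
     [&& #|p.1| == i.+1, p.2 \subset p.1 & (i.+1 <= 20 * #|p.2|)%N]].
(* The factor is nonnegative because [i + 1 <= n <= C(n, i)]. *)
have q0 : 0 <= q.
  have b0 := bin_gt0R (ltnW i_n).
  have : INR i.+1 <= INR 'C(n, i).
    by apply/leq_INR/(leq_trans i_n)/leq_bin_self; rewrite i0.
  move=> le_b; rewrite /q; suff : INR i.+1 / (50 * INR 'C(n, i)) <= 1 by lra.
  by apply: Rle_divl; lra.
pose F C := \big[Rplus/0]_(p | P p) indic (survivors p.1 p.2) C.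
pose g := indic (fun C => ~ good i.+1 C /\ unblocked h i C).
have gF C : g C <= F C.
  apply: indic_le; first by apply: rsum_ge0 => p _; apply: indic_ge0.
  move=> [ngC ub]; have [p Pp sp] := not_good_survivors ngC ub.
  rewrite /F (bigD1 p) //= indicT //.
  set S := \big[_/_]_(_ | _) _.
  have : 0 <= S by apply: rsum_ge0 => p' _; apply: indic_ge0.
  by lra.
have g1 C : g C <= 1 by apply: indic_le1.
apply: (@Rle_trans _ (run (t + w) (fun C => g C + indic (fun C => ~ unblocked h i C) C) start)).
  apply: run_leT => C; apply: indic_le.
    by have := indic_ge0 (fun C => ~ good i.+1 C /\ unblocked h i C) C;
      have := indic_ge0 (fun C => ~ unblocked h i C) C; rewrite /g; lra.
  move=> ngC; have [ub|nub] := classic (unblocked h i C).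
    have := indic_ge0 (fun C => ~ unblocked h i C) C.
    by have -> : g C = 1 by [apply: indicT]; lra.
  have := indic_ge0 (fun C => ~ good i.+1 C /\ unblocked h i C) C; rewrite -/(g C).
  by have -> : indic (fun C => ~ unblocked h i C) C = 1 by [apply: indicT]; lra.
rewrite run_add; apply: Rplus_le_compat_r; rewrite runD.
set N := INR 'C(n, i.+1) * 2 ^ i.+1 * q ^ w.
apply: (@Rle_trans _ (run t (fun C => indic (fun C => ~ good i C) C + N) start)); last first.
  by rewrite run_add run_cst; lra.
apply: (@run_le _ (fun C => set0 \in C)); [exact: stable_rooted| |exact: start_rooted].
move=> C C0.
have qw : 0 <= q ^ w by apply: pow_le.
have N0 : 0 <= N.
  apply: Rmult_le_pos => //; apply: Rmult_le_pos; first exact: pos_INR.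
  by apply: pow_le; lra.
have [gC|ngC] := classic (good i C); last first.
  rewrite indicT //; apply: (@Rle_trans _ (run w (fun=> 1) C)); last by rewrite run_cst; lra.
  exact: run_leT.
apply: (@Rle_trans _ (run w F C)); first exact: run_leT.
rewrite run_sum; apply: (@Rle_trans _ (\big[Rplus/0]_(p | P p) q ^ w)).
  apply: rsum_le => p /and3P[/eqP p1 p2 p3].
  apply: (@Rle_trans _ (q ^ w * indic (survivors p.1 p.2) C)).
    apply: (@run_supermartingale _ (fun C => set0 \in C /\ good i C)) => //.
      exact: (stable_and stable_rooted (@stable_good n i)).
    by move=> D [D0 gD]; apply: step_survivors.
  by have := indic_le1 (survivors p.1 p.2) C; nra.
rewrite rsum_const; apply: (@Rle_trans _ N); last first.
  by have := indic_ge0 (fun C => ~ good i C) C; lra.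
apply: Rmult_le_compat_r => //.
by have := leq_INR card_survivor_pairs; rewrite INRM INRX.
Qed.

(** Markov's inequality for [exp (lam * blocking)] at the threshold [1 / 2], summed over the level
    of [z], handles the first clause of [unblocked]. For the second, connectedness reduces to an
    occupied vertex on level [h], bounded by the expected size of that level. *)
Lemma run_not_unblocked t lam : (3 * h <= n)%N -> (i < h)%N ->
  0 <= lam -> 2 * lam <= INR (n - i) ->
  run t (indic (fun C => ~ unblocked h i C)) start <=
  INR 'C(n, i) * exp (INR t * (4 * lam / INR 'C(n, i.+1)) - lam / 2) +
  run t (fun C => INR (level_size C h)) start.
Proof.
move=> hn ih lam0 lam_le.
pose F C := \big[Rplus/0]_(z : {set 'I_n} | #|z| == i)
   (exp (- (lam / 2)) * exp (lam * blocking h z C)).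
have F0 C : 0 <= F C.
  apply: rsum_ge0 => z _; rewrite -exp_plus; apply/Rlt_le/exp_pos.
apply: (@Rle_trans _ (run t (fun C => F C + INR (level_size C h)) start)).
  apply: (@run_le _ (fun C => set0 \in C /\ connected C)).
  - exact: stable_connected.
  - move=> C [C0 conn]; have L0 := pos_INR (level_size C h); have FC := F0 C.
    apply: indic_le; first by lra.
    move=> nub; have [blk|] := classic (forall z : {set 'I_n}, #|z| = i -> blocking h z C
      <= 1 / 2).
      suff : 1 <= INR (level_size C h) by lra.
      rewrite -[1]/(INR 1); apply: leq_INR.
      apply: NNPP => L1; apply: nub; split=> // v vC; rewrite ltnNge; apply/negP => hv.
      by apply: L1; apply: (connected_level conn vC).
    move=> nblk.
    have [z zi lt_b] : exists2 z : {set 'I_n}, #|z| = i & 1 / 2 < blocking h z C.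
      apply: NNPP => none; apply: nblk => z zi; apply: Rnot_lt_le => lt_b.
      by apply: none; exists z.
    suff : 1 <= F C by lra.
    rewrite /F (bigD1 z) /=; last by rewrite zi.
    set S := \big[_/_]_(_ | _) _.
    have : 0 <= S by apply: rsum_ge0 => v _; rewrite -exp_plus; apply/Rlt_le/exp_pos.
    rewrite -exp_plus.
    have := exp_ineq1_le (- (lam / 2) + lam * blocking h z C); nra.
  - split; first exact: start_rooted.
    by move=> v; rewrite inE => /eqP-> /eqP.
rewrite run_add; apply: Rplus_le_compat_r; rewrite run_sum.
have cE : INR 'C(n, i) = INR #|[set z : {set 'I_n} | #|z| == i]|.
  by have := card_draws 'I_n i; rewrite card_ord => ->.
rewrite cE -rsum_const_set.
rewrite [X in _ <= X](eq_bigl (fun z : {set 'I_n} => #|z| == i)); last by move=> z; rewrite inE.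
apply: rsum_le => z /eqP zi; rewrite run_scale.
have -> : INR t * (4 * lam / INR 'C(n, i.+1)) - lam / 2 =
   - (lam / 2) + INR t * (4 * lam / INR 'C(n, i.+1)) by ring.
rewrite exp_plus; apply: Rmult_le_compat_l; first exact/Rlt_le/exp_pos.
apply: (@Rle_trans _ (exp (4 * lam / INR 'C(n, i.+1)) ^ t * exp (lam * blocking h z start))).
  apply: (@run_supermartingale _ (fun C => set0 \in C)).
  - exact: stable_rooted.
  - exact/Rlt_le/exp_pos.
  - by move=> C C0; rewrite -zi; apply: step_exp_blocking; rewrite // zi.
  - exact: start_rooted.
have -> : blocking h z start = 0.
  rewrite /blocking big1 // => w /andP[]; rewrite inE => /eqP-> /andP[/proper_card].
  by rewrite cards0.
rewrite Rmult_0_r exp_0 Rmult_1_r; right.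
elim: t => [|t IH]; first by rewrite /= Rmult_0_l exp_0.
by rewrite S_INR Rmult_plus_distr_r exp_plus Rmult_1_l -IH /= Rmult_comm.
Qed.

End Phase1.

(** * Survival of unoccupied vertices *)

Section UnoccupiedEarly.
Variables (n k : nat).
Hypothesis k_n : (k <= n)%N.
Implicit Types (C : cluster n) (w x y : {set 'I_n}).

Lemma unocc_level_insert C w : w \notin C ->
  unocc_level C k = ((#|w| == k) + unocc_level (w |: C) k)%N.
Proof.
move=> wC; rewrite /unocc_level (cardsD1 w) inE wC andbT; congr (_ + _)%N.
apply: eq_card => x; rewrite !inE negb_or.
by case: (x == w); rewrite ?andbF.
Qed.

(** Each unoccupied vertex of the level is taken with probability at most [1 / C(n, k)], and
    [exp lam - 1 <= 2 * lam]. The bound has the same form with a smaller [lam], so it can be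
    iterated. *)
Lemma step_exp_unocc C lam : set0 \in C -> 0 <= lam <= 1 / 2 ->
  step (fun C => exp (- (lam * INR (unocc_level C k)))) C <=
  exp (- (lam * (1 - 2 / INR 'C(n, k)) * INR (unocc_level C k))).
Proof.
move=> C0 lam01; rewrite stepE //.
set u := INR (unocc_level C k); set e := exp (- (lam * u)); set m := INR 'C(n, k).
have m0 : 0 < m by apply: bin_gt0R.
have m0' := Rinv_0_lt_compat _ m0.
have e0 : 0 < e by apply: exp_pos.
have -> : - (lam * (1 - 2 / m) * u) = - (lam * u) + 2 * lam * u / m by field; lra.
rewrite exp_plus -/e.
apply: (@Rle_trans _ (e + e * (2 * lam * u / m))); last first.
  by have := exp_ineq1_le (2 * lam * u / m); nra.
apply: Rplus_le_compat_l.
apply: (@Rle_trans _ (\big[Rplus/0]_(w : {set 'I_n} | (w \notin C) && (#|w| == k)) (/ m *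
  (e * (2 * lam))))).
  rewrite [X in _ <= X]big_mkcondr; apply: rsum_le => w wC.
  have := unocc_level_insert wC; move/(congr1 INR); rewrite INRD -/u.
  set u' := INR (unocc_level _ k) => uE.
  case: eqP uE => [wk|_] /= uE; last first.
    by rewrite /e uE Rplus_0_l; lra.
  have -> : exp (- (lam * u')) - e = e * (exp lam - 1).
    have -> : - (lam * u') = - (lam * u) + lam by rewrite uE; ring.
    by rewrite exp_plus -/e; ring.
  have := attach_prob_le C w; have := attach_prob_ge0 C w; rewrite wk -/m => p0 pm.
  have := exp_sub1_le lam01; have := exp_ineq1_le lam => E1 E2.
  apply: Rmult_le_compat => //; first by apply: Rmult_le_pos; lra.
  by apply: Rmult_le_compat_l; lra.
rewrite rsum_const; right.
have -> : INR #|(fun w : {set 'I_n} => (w \notin C) && (#|w| == k))| = u.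
  by congr INR; apply: eq_card => w; rewrite !inE andbC.
by rewrite /Rdiv; ring.
Qed.

Lemma run_exp_unocc t C lam : (2 <= 'C(n, k))%N -> set0 \in C -> 0 <= lam <= 1 / 2 ->
  run t (fun C => exp (- (lam * INR (unocc_level C k)))) C <=
  exp (- (lam * (1 - 2 / INR 'C(n, k)) ^ t * INR (unocc_level C k))).
Proof.
move=> m2 + lam01; have m0 : 0 < INR 'C(n, k) by apply: bin_gt0R.
set q := 1 - _; have q01 : 0 <= q <= 1.
  have : 2 / INR 'C(n, k) <= 1.
    by apply: Rle_divl => //; have := leq_INR m2; rewrite -[INR 2]/2; lra.
  have : 0 <= 2 / INR 'C(n, k) by apply: Rle_divr; lra.
  by rewrite /q; lra.
elim: t C => [|t IH] C C0; first by rewrite /= Rmult_1_r; lra.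
apply: Rle_trans (step_le stable_rooted IH C0) _.
have qt : 0 <= q ^ t <= 1 by split; [apply: pow_le; lra | rewrite -(pow1 t); apply: pow_incr].
apply: Rle_trans (step_exp_unocc (lam := lam * q ^ t) C0 _) _; first by split; nra.
by rewrite -/q /=; right; congr (exp (- _)); ring.
Qed.

End UnoccupiedEarly.

(** [exp (- u) <= 1 / (1 + u)], and the right-hand side times [1 + u] is [1 + u ^ 2 * (1 + 2 * u)],
    at least [1]. *)
Lemma exp_opp_le_quadratic u : - (1 / 2) <= u -> exp (- u) <= 1 - u + 2 * u ^ 2.
Proof.
move=> u_ge; have e1 := exp_ineq1_le u; have e0 := exp_pos (- u).
have e2 : exp u * exp (- u) = 1 by rewrite -exp_plus Rplus_opp_r exp_0.
apply: (Rmult_le_reg_r (1 + u)); first by lra.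
by nra.
Qed.

(** * The weighted count of unoccupied vertices on level [k] *)

Section Phase2.
Variables (n k : nat).
Hypotheses (k_n : (k < n)%N).
Implicit Types (C : cluster n) (w x y : {set 'I_n}).

(** Chosen so that [(growth - 1) * (19 / 20) * (k + 1) = 1], the balance used in the drift
    estimate. *)
Definition growth : R := 1 + 20 / (19 * INR k.+1).

Definition occupied_above C x := #|[set a | (a \notin x) && (a |: x \in C)]|.

Definition weight C x : R := growth ^ occupied_above C x.

Definition total_weight C : R :=
  \big[Rplus/0]_(x : {set 'I_n} | (#|x| == k) && (x \notin C)) weight C x.

Definition weight_bound : R := growth ^ (n - k).

Definition weight_below C w : R :=
  \big[Rplus/0]_(x : {set 'I_n} | (#|x| == k) && (x \notin C) && (x \subset w)) weight C x.

(** The increment of [total_weight] when [w] is added. *)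
Definition weight_change C w : R :=
  if #|w| == k then - weight C w
  else if #|w| == k.+1 then (growth - 1) * weight_below C w else 0.

Lemma growth_ge1 : 1 <= growth.
Proof.
have := INR_gt0 (ltn0Sn k); rewrite /growth => k0.
have : 0 <= 20 / (19 * INR k.+1) by apply: Rle_divr; lra.
by lra.
Qed.

Lemma weight_ge1 C x : 1 <= weight C x.
Proof. exact: pow_R1_Rle growth_ge1. Qed.

Lemma weight_le C x : #|x| = k -> weight C x <= weight_bound.
Proof.
move=> xk; apply: Rle_pow; first exact: growth_ge1.
apply/leP; have := cardsC x; rewrite card_ord xk => xC.
have aux b : (k + b = n)%N -> b = (n - k)%N by lia.
rewrite -(aux _ xC).
by apply/subset_leq_card/subsetP => a; rewrite !inE => /andP[].
Qed.

Lemma occupied_above_insert C w x : w \notin C -> #|x| = k ->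
  occupied_above (w |: C) x =
  ((#|w| == k.+1) && (x \subset w) + occupied_above C x)%N.
Proof.
move=> wC xk; rewrite /occupied_above.
have [/andP[/eqP wk xw]|wx] := boolP ((#|w| == k.+1) && (x \subset w)).
  have /card_gt0P[a] : (0 < #|w :\: x|)%N.
    by have := cardsID x w; rewrite (setIidPr xw) xk wk; lia.
  rewrite inE => /andP[ax aw].
  have wE : a |: x = w.
    by apply/eqP; rewrite eqEcard subUset sub1set aw xw cardsU1 ax xk wk /=.
  rewrite (cardsD1 a) !inE ax wE eqxx /=; congr (_ + _)%N.
  apply: eq_card => b; rewrite !inE.
  case: (eqVneq b a) => [->|ba] /=; first by rewrite ax wE (negbTE wC).
  case: (boolP (b \in x)) => //= bx; case: eqP => // bw.
  by move: ba; have := setU11 b x; rewrite bw -wE !inE (negbTE bx) orbF => ->.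
rewrite add0n; apply: eq_card => b; rewrite !inE.
case: (boolP (b \in x)) => //= bx; case: eqP => // bw.
by move: wx; rewrite -bw cardsU1 bx xk subsetUr eqxx.
Qed.

Lemma total_weight_insert C w : w \notin C ->
  total_weight (w |: C) = total_weight C + weight_change C w.
Proof.
move=> wC; rewrite /weight_change.
have aux (a b c : R) : a = b + c -> c = a + - b by lra.
case: eqP => [wk|wk].
  apply: aux; rewrite [total_weight C]/total_weight (bigD1 w) /= ?wk ?eqxx //; congr (_ + _).
  apply: eq_big => [x|x /andP[/andP[/eqP xk xC] xw]].
    by rewrite in_setU1 negb_or andbCA andbC.
  by rewrite /weight occupied_above_insert // wk; case: eqP => [|_] //=; lia.
case: eqP => [wk1|wk1]; last first.
  rewrite Rplus_0_r; apply: eq_big => [x|x /andP[/eqP xk xC]].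
    rewrite in_setU1 negb_or; case: eqP => //= xk; case: eqP => // xw.
    by case: wk; rewrite -xw.
  by rewrite /weight occupied_above_insert //; case: eqP.
rewrite /weight_below rsum_mull [X in _ + X]big_mkcondr /= -big_split /=.
apply: eq_big => [x|x /andP[/eqP xk xC]].
  rewrite in_setU1 negb_or; case: eqP => //= xk; case: eqP => // xw.
  by case: wk; rewrite -xw.
rewrite /weight occupied_above_insert // wk1 eqxx /=.
by case: (x \subset w) => /=; rewrite ?add1n ?add0n /=; ring.
Qed.

Lemma weight_below_ge0 C w : 0 <= weight_below C w.
Proof.
by apply: rsum_ge0 => x _; have := weight_ge1 C x; lra.
Qed.

Lemma weight_below_le C w : #|w| = k.+1 ->
  weight_below C w <= INR k.+1 * weight_bound.
Proof.
move=> wk; apply: (@Rle_trans _ (\big[Rplus/0]_(x in [set x : {set 'I_n} | x \subset w &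
  #|x| == k]) weight_bound)).
  apply: (@Rle_trans _ (\big[Rplus/0]_(x : {set 'I_n} | (#|x| == k) && (x \notin C) && (x
    \subset w)) weight_bound)).
    by apply: rsum_le => x /andP[/andP[/eqP xk _] _]; apply: weight_le.
  apply: rsum_subset_le => [x /andP[/andP[xk _] xw]|x _]; first by rewrite inE xw xk.
  by apply: pow_le; have := growth_ge1; lra.
rewrite rsum_const_set cards_draws wk binSn; lra.
Qed.

(** On level [k.+1] there are at most [k + 1] lower neighbours, and
    [(growth - 1) * (k + 1) = 20 / 19]. *)
Lemma weight_change_bound C w : Rabs (weight_change C w) <= 2 * weight_bound.
Proof.
have B0 : 0 < weight_bound by apply: pow_lt; have := growth_ge1; lra.
rewrite /weight_change; case: eqP => [wk|_].
  rewrite Rabs_Ropp Rabs_pos_eq; last by have := weight_ge1 C w; lra.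
  by have := weight_le C wk; lra.
case: eqP => [wk|_]; last by rewrite Rabs_R0; lra.
have := weight_below_le C wk; have := weight_below_ge0 C w; have := growth_ge1.
have k0 := INR_gt0 (ltn0Sn k).
have gE : (growth - 1) * INR k.+1 = 20 / 19 by rewrite /growth; field; lra.
move=> g1 D0 D_le; rewrite Rabs_pos_eq; last by apply: Rmult_le_pos; lra.
apply: Rle_trans (Rmult_le_compat_l _ _ _ _ D_le) _; first by lra.
by rewrite -Rmult_assoc gE; lra.
Qed.

(* The drift of the total weight is nonnegative: a walk reaching [w] on level
   [k.+1] removes a given lower neighbour with probability at most [1 / k.+1],
   but occupies [w] with probability at least [19 / 20]. *)
Lemma weight_drift_ge0 C : good k.+1 C ->
  0 <= \big[Rplus/0]_(w | w \notin C) (attach_prob C w * weight_change C w).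
Proof.
move=> gC; have k0 := INR_gt0 (ltn0Sn k).
pose q w := reach_prob C w / INR k.+1.
have q0 w : 0 <= q w.
  by apply: Rmult_le_pos; [apply: reach_prob_ge0 | apply/Rlt_le/Rinv_0_lt_compat].
(* Expected loss: charge each removed [x] to the unoccupied [w] just above it that the walk comes
   from, then exchange the two sums. *)
have lower : \big[Rplus/0]_(w : {set 'I_n} | (w \notin C) && (#|w| == k)) (attach_prob C w
  * weight C w)
   <= \big[Rplus/0]_(w : {set 'I_n} | (w \notin C) && (#|w| == k.+1)) (q w * weight_below C w).
  apply: (@Rle_trans _ (\big[Rplus/0]_(x : {set 'I_n} | (x \notin C) && (#|x| == k))
     \big[Rplus/0]_(w : {set 'I_n} | [&& w \notin C, #|w| == k.+1 & x \subset w]) (q w *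
       weight C x))).
    apply: rsum_le => x /andP[xC /eqP xk].
    rewrite Rmult_comm; under [X in _ <= X]eq_bigr do rewrite Rmult_comm.
    rewrite -rsum_mull; apply: Rmult_le_compat_l; first by have := weight_ge1 C x; lra.
    have := @attach_prob_le_above n C x; rewrite xk => H; apply: H.
    exact: k_n.
  rewrite (exchange_big_dep (fun w : {set 'I_n} => (w \notin C) && (#|w| == k.+1))) /=;
    last first.
    by move=> x w _ /and3P[-> ->].
  apply: rsum_le => w /andP[wC wk]; rewrite /weight_below rsum_mull; right.
  by apply: eq_bigl => x; rewrite wC wk /= [(x \notin C) && _]andbC.
(* Expected gain: by [good], [w] is attached with probability at least [q w * (19 / 20) * (k + 1)],
   and multiplying by [growth - 1] leaves [q w]. *)
have upper : \big[Rplus/0]_(w : {set 'I_n} | (w \notin C) && (#|w| == k.+1)) (q w *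
  weight_below C w)
  <= \big[Rplus/0]_(w : {set 'I_n} | (w \notin C) && (#|w| == k.+1)) (attach_prob C w *
    ((growth - 1) * weight_below C w)).
  apply: rsum_le => w /andP[wC /eqP wk].
  rewrite -Rmult_assoc; apply: Rmult_le_compat_r; first exact: weight_below_ge0.
  have w0 : (0 < #|w|)%N by rewrite wk.
  have := attach_prob_ge C w0; rewrite wk.
  have occ : 19 / 20 * INR k.+1 <= INR (occupied_below C w).
    have := occupied_belowD C w; have := gC w wk; rewrite wk => /leq_INR; rewrite INRM INR_20.
    by move=> ? /(congr1 INR); rewrite INRD; lra.
  have gE : (growth - 1) * (19 / 20 * INR k.+1) = 1 by rewrite /growth; field; lra.
  have -> : reach_prob C w * INR (occupied_below C w) / INR k.+1 = q w * INR
    (occupied_below C w).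
    by rewrite /q /Rdiv; ring.
  set o := INR (occupied_below C w) in occ *; set p := attach_prob C w; move=> p_ge.
  have g1 := growth_ge1; have qw := q0 w.
  apply: (@Rle_trans _ (q w * o * (growth - 1))); last by apply: Rmult_le_compat_r; lra.
  rewrite Rmult_assoc -[X in X <= _]Rmult_1_r; apply: Rmult_le_compat_l => //.
  have : (growth - 1) * (19 / 20 * INR k.+1) <= (growth - 1) * o.
    by apply: Rmult_le_compat_l; lra.
  by rewrite gE; lra.
have -> : \big[Rplus/0]_(w | w \notin C) (attach_prob C w * weight_change C w) =
  \big[Rplus/0]_(w : {set 'I_n} | (w \notin C) && (#|w| == k.+1)) (attach_prob C w *
    ((growth - 1) * weight_below C w))
  - \big[Rplus/0]_(w : {set 'I_n} | (w \notin C) && (#|w| == k)) (attach_prob C w * weight C w).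
  rewrite [X in X - _]big_mkcondr [X in _ - X]big_mkcondr /= -rsum_sub.
  apply: eq_bigr => w _; rewrite /weight_change.
  case: eqP => [->|_]; first by rewrite eqn_leq ltnn andbF; ring.
  by case: eqP => _; ring.
by lra.
Qed.

Definition two_levels C := (level_size C k + level_size C k.+1)%N.

(** [two_levels] serves as a clock that advances only when the total weight can move; the [mu] term
    pays for the second-order error of such a move. *)
Definition potential lam mu C : R :=
  exp (- (lam * total_weight C) - mu * INR (two_levels C)).

(** A move [d] satisfies [Rabs d <= 2 * B], so [lam * d] is at most [1 / 2] in absolute value and
    the quadratic error [2 * (lam * d) ^ 2] is at most [mu]. The clock supplies
    [exp (- mu) <= 1 / (1 + mu)], and only a linear term remains, whose sum has the right sign by
    the drift estimate. *)
Lemma step_potential lam C : set0 \in C -> good k.+1 C -> 0 <= lam ->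
  4 * lam * weight_bound <= 1 ->
  step (potential lam (8 * (lam * weight_bound) ^ 2)) C <=
  1 * potential lam (8 * (lam * weight_bound) ^ 2) C.
Proof.
set B := weight_bound; set mu := 8 * _ => C0 gC lam0 lamB; rewrite stepE //.
set P := potential lam mu C; have P0 : 0 < P by apply: exp_pos.
have mu0 : 0 <= mu by rewrite /mu; have := pow2_ge_0 (lam * B); lra.
suff : \big[Rplus/0]_(w | w \notin C) (attach_prob C w * (potential lam mu (w |: C) - P)) <=
   - (P * exp (- mu) * lam) * \big[Rplus/0]_(w | w \notin C) (attach_prob C w *
     weight_change C w).
  have := weight_drift_ge0 gC; set D := \big[_/_]_(_ | _) (_ * weight_change C _) => D0.
  have c0 : 0 <= P * exp (- mu) * lam.
    by apply: Rmult_le_pos => //; apply: Rmult_le_pos; [lra | apply/Rlt_le/exp_pos].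
  set S := \big[_/_]_(_ | _) _ => S_le; nra.
rewrite rsum_mull; apply: rsum_le => w wC.
have p0 := attach_prob_ge0 C w.
set d := weight_change C w.
have -> : - (P * exp (- mu) * lam) * (attach_prob C w * d) =
  attach_prob C w * (- (P * exp (- mu) * (lam * d))) by ring.
apply: Rmult_le_compat_l => //.
rewrite {1}/potential total_weight_insert // -/d.
have -> : two_levels (w |: C) = ((#|w| == k) + (#|w| == k.+1) + two_levels C)%N.
  by rewrite /two_levels /level_size !card_filter_insert //; lia.
set z := ((#|w| == k) + (#|w| == k.+1))%N.
have -> : exp (- (lam * (total_weight C + d)) - mu * INR (z + two_levels C)) =
   P * exp (- mu * INR z + - (lam * d)).
  by rewrite /P /potential -exp_plus INRD; congr exp; ring.
have := weight_change_bound C w; rewrite -/d -/B => d_le.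
have [[z0 d0]|z1] : (z = 0%N /\ d = 0) \/ z = 1%N.
- rewrite /z /d /weight_change; case: (eqVneq #|w| k) => [->|_].
    by right; rewrite eqn_leq ltnn andbF.
  by case: eqP => _; [right | left].
- rewrite z0 d0 !Rmult_0_r Ropp_0 Rplus_0_r exp_0; lra.
rewrite z1 Rmult_1_r exp_plus.
set E := exp (- mu).
have E0 : 0 < E by apply: exp_pos.
have E1 : E * (1 + mu) <= 1.
  have e2 : exp mu * E = 1 by rewrite -exp_plus Rplus_opp_r exp_0.
  by have := exp_ineq1_le mu; nra.
have B0 : 0 < B by apply: pow_lt; have := growth_ge1; lra.
have [d1 d2] : - (2 * B) <= d /\ d <= 2 * B.
  by move: d_le; rewrite /Rabs; case: Rcase_abs => ? ?; lra.
have ld1 : - (2 * (lam * B)) <= lam * d by nra.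
have ld2 : lam * d <= 2 * (lam * B) by nra.
have Q : exp (- (lam * d)) <= 1 - lam * d + 2 * (lam * d) ^ 2.
  by apply: exp_opp_le_quadratic; lra.
have sq : 2 * (lam * d) ^ 2 <= mu by rewrite /mu; nra.
have : E * exp (- (lam * d)) <= E * (1 + mu - lam * d) by apply: Rmult_le_compat_l; lra.
set X := exp (- (lam * d)) => EX.
have : P * (E * X) <= P * (1 - E * (lam * d)) by apply: Rmult_le_compat_l; lra.
by lra.
Qed.

Lemma two_levels_le C : (two_levels C <= 'C(n, k) + 'C(n, k.+1))%N.
Proof. by apply: leq_add; apply: level_size_le. Qed.

(** The total weight starts at [u] or more, since each weight is at least [1], and is at most
    [weight_bound] per unoccupied vertex. The event thus forces it below [u / 2], while the clock
    never exceeds the size of two full levels. *)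
Lemma run_unocc_small t C u lam : set0 \in C -> good k.+1 C ->
  u <= INR (unocc_level C k) -> 0 <= lam -> 4 * lam * weight_bound <= 1 ->
  run t (indic (fun D : cluster n => 2 * weight_bound * INR (unocc_level D k) < u)) C <=
  exp (- (lam * u / 2) +
       8 * (lam * weight_bound) ^ 2 * INR ('C(n, k) + 'C(n, k.+1))).
Proof.
move=> C0 gC u_le lam0 lamB; set mu := 8 * _; set N := INR _.
have mu0 : 0 <= mu by rewrite /mu; have := pow2_ge_0 (lam * weight_bound); lra.
(* Normalisation for Markov's inequality: [K * potential] is at least [1] on the event. *)
pose K := exp (lam * u / 2 + mu * N).
apply: (@Rle_trans _ (run t (fun D => K * potential lam mu D) C)).
  apply: run_leT => D; rewrite /K /potential -exp_plus.
  apply: indic_le; first exact/Rlt_le/exp_pos.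
  move=> lt_u.
  have W_le : total_weight D <= INR (unocc_level D k) * weight_bound.
    apply: (@Rle_trans _ (\big[Rplus/0]_(x in [set x : {set 'I_n} | (#|x| == k) && (x
      \notin D)]) weight_bound)).
      rewrite [X in _ <= X](eq_bigl (fun x : {set 'I_n} => (#|x| == k) && (x \notin D))).
        by apply: rsum_le => x /andP[/eqP xk _]; apply: weight_le.
      by move=> x; rewrite inE.
    by rewrite rsum_const_set /unocc_level; lra.
  have N_ge : INR (two_levels D) <= N by apply/leq_INR/two_levels_le.
  set X := _ + _; suff X0 : 0 <= X by have := exp_ineq1_le X; lra.
  rewrite /X; nra.
rewrite run_scale.
have sup : run t (potential lam mu) C <= 1 ^ t * potential lam mu C.
  apply: (@run_supermartingale _ (fun C => set0 \in C /\ good k.+1 C)) => //.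
  - exact: (stable_and stable_rooted (@stable_good n k.+1)).
  - by lra.
  - by move=> D [D0 gD]; apply: step_potential.
rewrite pow1 Rmult_1_l in sup.
apply: (@Rle_trans _ (K * exp (- (lam * u)))); last first.
  by right; rewrite /K -exp_plus; congr exp; field.
apply: Rmult_le_compat_l; first exact/Rlt_le/exp_pos.
apply: Rle_trans sup _; rewrite /potential.
have W_ge : u <= total_weight C.
  apply: Rle_trans u_le _.
  apply: (@Rle_trans _ (\big[Rplus/0]_(x in [set x : {set 'I_n} | (#|x| == k) && (x \notin
    C)]) 1)).
    by rewrite rsum_const_set /unocc_level; lra.
  rewrite (eq_bigl (fun x : {set 'I_n} => (#|x| == k) && (x \notin C))).
    by apply: rsum_le => x _; apply: weight_ge1.
  by move=> x; rewrite inE.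
have L0 := pos_INR (two_levels C).
have [lt_e|->] : - (lam * total_weight C) - mu * INR (two_levels C) <= - (lam * u) by nra.
  exact/Rlt_le/exp_increasing.
by lra.
Qed.

End Phase2.

(** * Elementary bounds on exponentials and binomial coefficients *)

Lemma INR_leq (a b : nat) : INR a <= INR b -> (a <= b)%N.
Proof. by move=> ab; apply/leP/INR_le. Qed.

Lemma exp_le x y : x <= y -> exp x <= exp y.
Proof. by move=> [/exp_increasing/Rlt_le|->] //; apply: Rle_refl. Qed.

Lemma ln_ge1 x : 3 <= x -> 1 <= ln x.
Proof.
move=> x3; apply: Rnot_lt_le => /exp_increasing; rewrite exp_ln; last by lra.
by have := exp_le_3; lra.
Qed.

Lemma exp_pow x j : exp x ^ j = exp (INR j * x).
Proof.
elim: j => [|j IH]; first by rewrite /= Rmult_0_l exp_0.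
by rewrite S_INR /= IH -exp_plus; congr exp; ring.
Qed.

Lemma pow_le_exp q x j : 0 <= q <= exp x -> q ^ j <= exp (INR j * x).
Proof. by move=> qx; rewrite -exp_pow; apply: pow_incr. Qed.

Lemma exp_le_1sub x : 0 <= x <= 1 / 2 -> exp (- (2 * x)) <= 1 - x.
Proof.
move=> [x0 x1]; have e1 := exp_ineq1_le (2 * x); have e0 := exp_pos (- (2 * x)).
have e2 : exp (2 * x) * exp (- (2 * x)) = 1 by rewrite -exp_plus Rplus_opp_r exp_0.
apply: (Rmult_le_reg_r (1 + 2 * x)); first by lra.
by nra.
Qed.

(** The left side is one term of the binomial expansion. *)
Lemma bin_mul_pow_le (m j : nat) (a : R) : 0 <= a -> INR 'C(m, j) * a ^ j <= (1 + a) ^ m.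
Proof.
move=> a0; have p0 i : 0 <= a ^ i by apply: pow_le.
elim: m j => [|m IH] [|j]; rewrite ?bin0 ?bin0n /=; try lra.
  by rewrite !Rmult_1_r; have := pow_R1_Rle (1 + a) m; nra.
by rewrite binS INRD; have := IH j.+1; have := IH j; rewrite /=; nra.
Qed.

(** This is [C(m, k) >= (m / k) ^ k], by induction through [k * C(m, k) = m * C(m - 1, k - 1)]; the
    hypothesis survives lowering both indices because [x >= 1]. *)
Lemma pow_le_bin (k m : nat) (x : R) : 1 <= x -> x * INR k <= INR m -> x ^ k <= INR 'C(m, k).
Proof.
move=> x1; elim: k m => [|k IH] m xk; first by rewrite bin0 /=; lra.
have k0 := pos_INR k; rewrite S_INR in xk.
case: m xk => [|m] xk; first by rewrite /= in xk; nra.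
rewrite S_INR in xk.
have m0 := pos_INR m.
have {}IH : x ^ k <= INR 'C(m, k) by apply: IH; lra.
have := mul_bin_diag m.+1 k => /(congr1 INR); rewrite /= !INRM !S_INR => bE.
have := INR_gt0 (ltn0Sn k); rewrite S_INR => k1.
apply: (Rmult_le_reg_l (INR k + 1)) => //; rewrite -bE.
have xk0 : 0 <= x ^ k by apply: pow_le; lra.
apply: (@Rle_trans _ ((INR m + 1) * x ^ k)); last first.
  by apply: Rmult_le_compat_l; lra.
by rewrite -Rmult_assoc; apply: Rmult_le_compat_r; lra.
Qed.

Lemma bin_leq_mono (m a b : nat) : (a <= b)%N -> (b <= m %/ 2)%N -> ('C(m, a) <= 'C(m, b))%N.
Proof.
move=> ab; rewrite -(subnKC ab); elim: (b - a)%N => [|j IH]; first by rewrite addn0.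
rewrite addnS => jm; apply: leq_trans (IH _) _; first by lia.
by have := mul_bin_left m (a + j); have : (a + j < m - (a + j))%N by [lia]; nia.
Qed.

(** * Estimates for a fixed level *)

Section FixedLevel.
Variables (n k : nat).
Hypotheses (n_large : 1000000 <= INR n) (k0 : (0 < k)%N).
Hypothesis k_small : 1000000 * INR k <= INR n.

(** At this time at most a hundredth of level [i] is occupied, yet enough walks have arrived to
    nearly fill level [i - 1] below each vertex of level [i]. *)
Definition milestone i := ('C(n, i) %/ 100)%N.

Lemma INR_100 : INR 100 = 100.
Proof. by rewrite INR_IZR_INZ. Qed.

Lemma INR_3 : INR 3 = 3.
Proof. by rewrite INR_IZR_INZ. Qed.

Lemma milestone_bounds i :
  INR 'C(n, i) / 100 - 1 <= INR (milestone i) <= INR 'C(n, i) / 100.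
Proof.
have := leq_trunc_div 'C(n, i) 100; have := @ltn_ceil 'C(n, i) 100 isT.
rewrite -/(milestone i) => /ltnW/leq_INR + /leq_INR.
by rewrite !INRM INR_100 S_INR; lra.
Qed.

Lemma k_ge1 : 1 <= INR k.
Proof. by rewrite -[1]/(INR 1); apply: leq_INR. Qed.

Lemma level_lt_third i : (i <= k.+1)%N -> (i < n %/ 3)%N.
Proof.
move=> ik; have := @ltn_ceil n 3 isT => /ltnW/leq_INR; rewrite INRM INR_3 S_INR.
have := leq_INR ik; rewrite S_INR => ik' n3; have k1 := k_ge1.
by apply: INR_leq; rewrite S_INR; lra.
Qed.

Lemma bin_ratio i : (i <= k)%N ->
  INR i.+1 * INR 'C(n, i.+1) = (INR n - INR i) * INR 'C(n, i).
Proof.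
move=> ik; have := level_lt_third (leqW ik); have := leq_trunc_div n 3 => ? ?.
rewrite -INRB; last by lia.
by rewrite -!INRM mul_bin_left.
Qed.

Lemma binS_ge i : (i <= k)%N -> 100000 * INR 'C(n, i) <= INR 'C(n, i.+1).
Proof.
move=> ik; have := bin_ratio ik; have ik' := leq_INR ik.
have := pos_INR i; have b0 := pos_INR 'C(n, i); have k1 := k_ge1.
rewrite S_INR => i0 bE; apply: (Rmult_le_reg_l (INR i + 1)); first by lra.
rewrite bE -Rmult_assoc; apply: Rmult_le_compat_r => //; lra.
Qed.

Lemma bin_n_ge i : (0 < i <= k.+1)%N -> INR n <= INR 'C(n, i).
Proof.
move=> /andP[i0 ik]; apply/leq_INR/leq_bin_self; rewrite i0 /=.
by have := level_lt_third ik; have := leq_trunc_div n 3; lia.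
Qed.

(** Take [a = 1 / 50000] in [bin_mul_pow_le]: this costs [n / 50000] in the exponent. The remaining
    factor [(2 / a) ^ j] is at most [exp (17 * j)] with [j <= 2 * k], which adds
    [34 / 1000000 * n]. *)
Lemma bin_pow2_le j : (j <= k.+1)%N -> INR 'C(n, j) * 2 ^ j <= exp (54 / 1000000 * INR n).
Proof.
move=> jk; have k1 := k_ge1.
have jk' : INR j <= 2 * INR k by have := leq_INR jk; rewrite S_INR; lra.
have a0 : 0 <= 1 / 50000 by lra.
have := bin_mul_pow_le n j a0.
have p0 : 0 < (1 / 50000) ^ j by apply: pow_lt; lra.
have e1 : (1 + 1 / 50000) ^ n <= exp (INR n * (1 / 50000)).
  by apply: pow_le_exp; split; [lra | apply: exp_ineq1_le].
have e2 : 100000 ^ j <= exp (INR j * 17).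
  apply: pow_le_exp; split; first by lra.
  have -> : 17 = INR 17 * 1 by rewrite Rmult_1_r INR_IZR_INZ.
  rewrite -exp_pow; apply: (@Rle_trans _ (2 ^ 17)); first by lra.
  by apply: pow_incr; have := exp_ineq1_le 1; lra.
move=> bin_le.
have -> : INR 'C(n, j) * 2 ^ j = INR 'C(n, j) * (1 / 50000) ^ j * 100000 ^ j.
  by rewrite Rmult_assoc -Rpow_mult_distr; congr (_ * _ ^ _); field.
apply: (@Rle_trans _ (exp (INR n * (1 / 50000)) * exp (INR j * 17))).
  apply: Rmult_le_compat => //; last by lra.
  - by apply: Rmult_le_pos; [apply: pos_INR | lra].
  - by apply: pow_le; lra.
by rewrite -exp_plus; apply: exp_le; lra.
Qed.

Lemma bin_le_exp j : (j <= k.+1)%N -> INR 'C(n, j) <= exp (54 / 1000000 * INR n).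
Proof.
move=> jk; apply: Rle_trans _ (bin_pow2_le jk).
by have := pow_R1_Rle 2 j; have := pos_INR 'C(n, j); nra.
Qed.

(** A common bound for all failure probabilities, up to polynomial factors in [n]. *)
Definition tiny : R := exp (- (INR n / 20000)).

(** Binomial coefficients increase up to level [n / 3], so every level above [k.+1] costs a factor
    [3]; at least [n / 4] such levels outweigh [C(n, k + 1)]. *)
Lemma run_top_level t : (t <= milestone k.+1)%N ->
  run t (fun C : cluster n => INR (level_size C (n %/ 3))) start <= tiny.
Proof.
move=> t_le; have kh := level_lt_third (leqnn k.+1).
have k1 := k_ge1.
have n3 := leq_trunc_div n 3.
set j := (n %/ 3 - k.+1)%N; have hE : (n %/ 3 = k.+1 + j)%N by lia.
rewrite hE; apply: (@Rle_trans _ (INR 'C(n, k.+1) * (/ 3) ^ j)).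
  apply: run_level_size_geom; [lra | lia | move=> l /andP[kl lh]].
  apply: (@Rle_trans _ (INR 'C(n, k.+1))).
    have [_ m_le] := milestone_bounds k.+1; have := leq_INR t_le.
    by have := pos_INR 'C(n, k.+1); lra.
  by apply: leq_INR; apply: bin_leq_mono => //; lia.
have j_ge : INR n / 4 <= INR j.
  rewrite /j INRB; last by lia.
  have := @ltn_ceil n 3 isT => /ltnW/leq_INR; rewrite INRM INR_3 !S_INR.
  by move=> ?; lra.
have e3 : (/ 3) ^ j <= exp (INR j * -1).
  apply: pow_le_exp; split; first by lra.
  rewrite exp_Ropp; apply: Rinv_le_contravar; [exact: exp_pos | exact: exp_le_3].
apply: (@Rle_trans _ (exp (54 / 1000000 * INR n) * exp (INR j * -1))).
  apply: Rmult_le_compat; [exact: pos_INR | by apply: pow_le; lra | exact: bin_le_exp |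
    exact: e3].
by rewrite /tiny -exp_plus; apply: exp_le; lra.
Qed.

Lemma run_not_unblocked_le i : (0 < i <= k)%N ->
  run (milestone i.+1) (indic (fun C : cluster n => ~ unblocked (n %/ 3) i C)) start
  <= 2 * tiny.
Proof.
move=> /andP[i0 ik]; have ih := level_lt_third (leqW ik).
have n3 := leq_trunc_div n 3; have k1 := k_ge1.
have i_n : (i < n)%N by lia.
have ni : INR (n - i) = INR n - INR i by rewrite INRB //; lia.
have ik' := leq_INR ik; have i0' := pos_INR i.
(* The largest value that [2 * lam <= n - i] allows; at time [C(n, i + 1) / 100] the exponent is at
   most [lam / 25 - lam / 2]. *)
set lam := (INR n - INR i) / 2.
have lam0 : 0 <= lam by rewrite /lam; lra.
have lam_le : 2 * lam <= INR (n - i) by rewrite ni /lam; lra.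
have hn : (3 * (n %/ 3) <= n)%N by lia.
apply: Rle_trans (run_not_unblocked (milestone i.+1) hn ih lam0 lam_le) _.
have -> : 2 * tiny = tiny + tiny by ring.
apply: Rplus_le_compat; last first.
  apply: run_top_level.
  rewrite /milestone; apply: leq_div2r; apply: bin_leq_mono; first by lia.
  by have := level_lt_third (leqnn k.+1); lia.
apply: (@Rle_trans _ (exp (54 / 1000000 * INR n) * exp (- (INR n / 10)))).
  apply: Rmult_le_compat; [exact: pos_INR | exact/Rlt_le/exp_pos | by apply: bin_le_exp;
    lia | ].
  apply: exp_le.
  have [_ m_le] := milestone_bounds i.+1.
  have b0 : 0 < INR 'C(n, i.+1) by apply: bin_gt0R.
  have -> : INR (milestone i.+1) * (4 * lam / INR 'C(n, i.+1)) =
     4 * lam * (INR (milestone i.+1) / INR 'C(n, i.+1)) by rewrite /Rdiv; ring.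
  have : INR (milestone i.+1) / INR 'C(n, i.+1) <= 1 / 100 by apply: Rle_divl; lra.
  set y := _ / INR 'C(n, i.+1) => y_le.
  have : 4 * lam * y <= 4 * lam * (1 / 100) by apply: Rmult_le_compat_l; lra.
  by rewrite /lam; lra.
by rewrite /tiny -exp_plus; apply: exp_le; lra.
Qed.

Lemma milestone_le i : (i <= k)%N -> (milestone i <= milestone i.+1)%N.
Proof.
move=> ik; apply: leq_div2r; apply: bin_leq_mono => //.
by have := level_lt_third (leqW ik); lia.
Qed.

(** The waiting time is at least [C(n, i + 1) / 125], so the decay exponent is at least
    [(n - i) / 6250], by the ratio of consecutive binomial coefficients. This beats the
    [54 / 1000000 * n] of the number of pairs. *)
Lemma survivors_term_le i : (0 < i <= k)%N ->
  INR 'C(n, i.+1) * 2 ^ i.+1 *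
    (1 - INR i.+1 / (50 * INR 'C(n, i))) ^ (milestone i.+1 - milestone i) <= tiny.
Proof.
move=> /andP[i0 ik]; have k1 := k_ge1; have ik' := leq_INR ik.
have i_n : (i < n)%N by have := level_lt_third (leqW ik); have := leq_trunc_div n 3; lia.
have b0 : 0 < INR 'C(n, i) by apply: bin_gt0R; lia.
have b1 : 0 < INR 'C(n, i.+1) by apply: bin_gt0R.
set w := (_ - milestone i)%N.
have w_ge : INR 'C(n, i.+1) / 125 <= INR w.
  rewrite /w INRB; last exact: milestone_le.
  have [m1 _] := milestone_bounds i.+1; have [_ m2] := milestone_bounds i.
  have := binS_ge ik; have : INR n <= INR 'C(n, i.+1) by apply: bin_n_ge.
  by lra.
set x := INR i.+1 / (50 * INR 'C(n, i)).
have i1 := INR_gt0 (ltn0Sn i).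
have x0 : 0 <= x by apply: Rle_divr; lra.
have x1 : x <= 1.
  apply: Rle_divl; first by lra.
  have : INR n <= INR 'C(n, i) by apply: bin_n_ge; lia.
  by rewrite S_INR; lra.
have q_le : (1 - x) ^ w <= exp (INR w * - x).
  by apply: pow_le_exp; split; [lra | have := exp_ineq1_le (- x); lra].
have wx : 15 / 100000 * INR n <= INR w * x.
  apply: (@Rle_trans _ (INR 'C(n, i.+1) / 125 * x)); last by apply: Rmult_le_compat_r.
  have -> : INR 'C(n, i.+1) / 125 * x = (INR i.+1 * INR 'C(n, i.+1)) / INR 'C(n, i) / 6250.
    by rewrite /x; field; lra.
  rewrite bin_ratio //.
  have -> : (INR n - INR i) * INR 'C(n, i) / INR 'C(n, i) = INR n - INR i by field; lra.
  by lra.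
apply: (@Rle_trans _ (exp (54 / 1000000 * INR n) * exp (INR w * - x))).
  apply: Rmult_le_compat => //.
  - by apply: Rmult_le_pos; [lra | apply: pow_le; lra].
  - by apply: pow_le; lra.
  - by apply: bin_pow2_le.
by rewrite /tiny -exp_plus; apply: exp_le; lra.
Qed.

Lemma good1 (C : cluster n) : set0 \in C -> good 1 C.
Proof.
move=> C0 y /eqP/cards1P[a ->].
suff -> : unoccupied_below C [set a] = 0%N by rewrite muln0.
apply/eqP; rewrite cards_eq0; apply/eqP/setP => b; rewrite !inE.
by case: eqP => //= ->; rewrite setDv C0.
Qed.

(** Level [1] is certain, since its only lower neighbour [set0] is occupied. Each further level adds
    one [tiny] for surviving pairs and two for blocking. *)
Lemma run_not_good_le i : (0 < i <= k.+1)%N ->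
  run (milestone i) (indic (fun C : cluster n => ~ good i C)) start
  <= 3 * INR (i - 1) * tiny.
Proof.
elim: i => // -[|i] IH ik.
  rewrite subnn /= Rmult_0_r Rmult_0_l -[X in _ <= X](@run_cst n (milestone 1) 0 start).
  apply: (@run_le _ (fun C => set0 \in C)); [exact: stable_rooted| |exact: start_rooted].
  by move=> C C0; rewrite indicF; [lra | move=> []; apply: good1].
have ik' : (0 < i.+1 <= k)%N by lia.
have i_n : (i.+1 < n)%N.
  by have := level_lt_third (i := i.+2) ltac:(lia); have := leq_trunc_div n 3; lia.
have := @run_not_good n (n %/ 3) i.+1 isT i_n (milestone i.+1) (milestone i.+2 - milestone
  i.+1).
rewrite subnKC; last by apply: milestone_le; lia.
move=> H; apply: Rle_trans H _.
have ik1 : (0 < i.+1 <= k.+1)%N by lia.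
apply: Rle_trans (Rplus_le_compat _ _ _ _ (Rplus_le_compat _ _ _ _ (IH ik1)
  (survivors_term_le ik')) (run_not_unblocked_le ik')) _.
have -> : (i.+2 - 1 = (i.+1 - 1).+1)%N by lia.
by rewrite S_INR; lra.
Qed.

End FixedLevel.

(** * Combining the two phases on one level [k] *)

Section LevelCount.
Variables (n k : nat).
Hypotheses (n_large : 1000000 <= INR n) (k0 : (0 < k)%N).
Hypothesis k_small : 1000000 * INR k <= INR n.
Hypothesis k_large : 100 * INR n / ln (INR n) <= INR k ^ 2.

Let m := INR 'C(n, k).
Let ratio := (INR n - INR k) / INR k.+1.

Let k1 : 1 <= INR k := k_ge1 k0.

Lemma k_lt_n : (k.+1 < n)%N.
Proof.
by have := level_lt_third n_large k0 k_small (leqnn k.+1); have := leq_trunc_div n 3; lia.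
Qed.

Lemma ratio_bounds : 1 <= ratio <= INR n / INR k.
Proof.
rewrite /ratio S_INR; split; first by apply: Rle_divr; lra.
by apply: Rle_divl; [lra | apply: Rle_trans (_ : INR n <= _); [lra | ]];
  have -> : INR n / INR k * (INR k + 1) = INR n + INR n / INR k by [field; lra];
  have : 0 <= INR n / INR k by [apply: Rle_divr; lra]; lra.
Qed.

Lemma binS_ratio : INR 'C(n, k.+1) = m * ratio.
Proof.
have := bin_ratio n_large k0 k_small (leqnn k); rewrite /m /ratio => bE.
have := INR_gt0 (ltn0Sn k) => k1'.
apply: (Rmult_eq_reg_l (INR k.+1)); last by lra.
by rewrite bE; field; lra.
Qed.

Lemma ln_n_bounds : 1 <= ln (INR n) <= 2 * sqrt (INR n).
Proof.
have n0 : 0 < INR n by lra.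
split; first by apply: ln_ge1; lra.
have s0 : 0 < sqrt (INR n) by apply: sqrt_lt_R0.
have -> : ln (INR n) = ln (sqrt (INR n)) + ln (sqrt (INR n)).
  by rewrite -ln_mult // sqrt_sqrt; lra.
have := exp_ineq1_le (ln (sqrt (INR n))); rewrite exp_ln //.
by lra.
Qed.

(** If [ln (n / k)] is at least a quarter of [ln n], the lower bound on [k] gives [25 * n].
    Otherwise [(n / k) ^ 4 <= n], and [k ^ 2] alone exceeds [6 * n]. *)
Lemma log_ratio_large : 6 * INR n <= INR k ^ 2 * ln (INR n / INR k).
Proof.
set r := INR n / INR k; have [ln1 _] := ln_n_bounds.
have r_ge : 1000000 <= r by apply: Rle_divr; lra.
have L1 : 1 <= ln r by apply: ln_ge1; lra.
have k2 : 0 <= INR k ^ 2 by apply: pow2_ge_0.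
have [le_L|lt_L] := Rle_lt_dec (ln (INR n) / 4) (ln r).
  apply: (@Rle_trans _ (100 * INR n / ln (INR n) * (ln (INR n) / 4))).
    have -> : 100 * INR n / ln (INR n) * (ln (INR n) / 4) = 25 * INR n by field; lra.
    by lra.
  apply: Rmult_le_compat => //; last by lra.
  by apply: Rle_divr; lra.
have r4 : r ^ 4 <= INR n.
  rewrite -{1}[r]exp_ln; last by lra.
  rewrite exp_pow -[X in _ <= X]exp_ln; last by lra.
  have -> : INR 4 = 4 by rewrite INR_IZR_INZ.
  by apply: exp_le; lra.
have nE : INR n = r * INR k by rewrite /r; field; lra.
have r2 : 6 * r ^ 2 <= INR n.
  apply: Rle_trans _ r4; have -> : r ^ 4 = r ^ 2 * r ^ 2 by ring.
  by apply: Rmult_le_compat_r; [apply: pow2_ge_0 | nra].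
apply: (@Rle_trans _ (INR k ^ 2 * 1)); last exact: Rmult_le_compat_l.
rewrite Rmult_1_r.
apply: (Rmult_le_reg_l (r ^ 2)); first by nra.
have -> : r ^ 2 * INR k ^ 2 = INR n * INR n by rewrite nE; ring.
have -> : r ^ 2 * (6 * INR n) = (6 * r ^ 2) * INR n by ring.
by apply: Rmult_le_compat_r; lra.
Qed.

(** From [ln n <= 2 * sqrt n] follows [k ^ 4 >= 2500 * n]. Then [exp (k / 2) >= (k / 24) ^ 12] is at
    least of order [n ^ 3]. *)
Lemma exp_half_k_ge : 2048 * INR n <= exp (INR k / 2).
Proof.
have [ln1 ln2] := ln_n_bounds; have n0 : 0 < INR n by lra.
have s0 : 0 < sqrt (INR n) by apply: sqrt_lt_R0.
have ss := sqrt_sqrt _ (Rlt_le _ _ n0).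
have kk : 50 * sqrt (INR n) <= INR k ^ 2.
  apply: Rle_trans _ k_large; apply: Rle_divr; first by lra.
  apply: (@Rle_trans _ (50 * sqrt (INR n) * (2 * sqrt (INR n)))); last by nra.
  by apply: Rmult_le_compat_l; lra.
have k4 : 2500 * INR n <= INR k ^ 4.
  have -> : INR k ^ 4 = INR k ^ 2 * INR k ^ 2 by ring.
  have -> : 2500 * INR n = (50 * sqrt (INR n)) * (50 * sqrt (INR n)).
    by rewrite -{1}ss; ring.
  by apply: Rmult_le_compat; lra.
have -> : INR k / 2 = INR 12 * (INR k / 24).
  have -> : INR 12 = 12 by rewrite INR_IZR_INZ.
  by field.
rewrite -exp_pow; apply: (@Rle_trans _ ((INR k / 24) ^ 12)); last first.
  by apply: pow_incr; split; [lra | have := exp_ineq1_le (INR k / 24); lra].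
have -> : (INR k / 24) ^ 12 = (INR k ^ 4) ^ 3 / 24 ^ 12 by field.
apply: Rle_divr; first by lra.
apply: (@Rle_trans _ ((2500 * INR n) ^ 3)); last by apply: pow_incr; lra.
have n2 : 1000000 * 1000000 <= INR n * INR n by apply: Rmult_le_compat; lra.
have -> : (2500 * INR n) ^ 3 = 2500 ^ 3 * (INR n * INR n) * INR n by ring.
have -> : 2048 * INR n * 24 ^ 12 = (2048 * 24 ^ 12) * INR n by ring.
by apply: Rmult_le_compat_r; lra.
Qed.

(** In [C(n, k) >= exp (k * ln (n / k))], half of the exponent pays for [3 * ratio] by
    [log_ratio_large], the other half for [2048 * n]. This size makes the level large enough for
    concentration. *)
Lemma m_ge : exp (3 * ratio) * (2048 * INR n) <= m.
Proof.
have [_ r_le] := ratio_bounds; have logr := log_ratio_large.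
set r := INR n / INR k in r_le logr.
have r_ge : 1000000 <= r by apply: Rle_divr; lra.
have L1 : 1 <= ln r by apply: ln_ge1; lra.
apply: (@Rle_trans _ (r ^ k)); last first.
  apply: pow_le_bin; first by lra.
  by rewrite /r; right; field; lra.
rewrite -{1}[r]exp_ln; last by lra.
rewrite exp_pow.
apply: (@Rle_trans _ (exp (3 * r) * exp (INR k / 2))).
  apply: Rmult_le_compat; [exact/Rlt_le/exp_pos | lra | by apply: exp_le; lra | exact:
    exp_half_k_ge].
rewrite -exp_plus; apply: exp_le.
have : 3 * r <= INR k * ln r / 2.
  have -> : 3 * r = (6 * INR n) / (2 * INR k) by rewrite /r; field; lra.
  apply: Rle_divl; first by lra.
  by apply: Rle_trans logr _; right; rewrite -/r; field.
by nra.
Qed.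

(** The number of vertices of level [k] that remain unoccupied at time [milestone n k.+1], outside
    an event of small probability. *)
Let u0 := m / 2 * exp (- (ratio / 25)).

Let m0 : 0 < m.
Proof. by apply: bin_gt0R; have := k_lt_n; lia. Qed.

Lemma unocc_level_start : unocc_level (start : cluster n) k = 'C(n, k).
Proof.
rewrite /unocc_level -[in RHS](card_ord n) -card_draws; apply: eq_card => x; rewrite !inE.
by case: (eqVneq #|x| k) => //= xk; rewrite -card_gt0 xk.
Qed.

Lemma u0_ge : INR n <= u0.
Proof.
have [r1 r2] := ratio_bounds; have mg := m_ge.
have e1 : 1 <= exp (2 * ratio) by have := exp_ineq1_le (2 * ratio); lra.
rewrite /u0; apply: (@Rle_trans _ (exp (3 * ratio) * (2048 * INR n) / 2 * exp (- (ratio /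
  25)))); last first.
  by apply: Rmult_le_compat_r; [exact/Rlt_le/exp_pos | lra].
have -> : exp (3 * ratio) * (2048 * INR n) / 2 * exp (- (ratio / 25)) =
   (1024 * INR n) * (exp (3 * ratio) * exp (- (ratio / 25))) by field.
rewrite -exp_plus.
have : 1 <= exp (3 * ratio + - (ratio / 25)).
  by have := exp_ineq1_le (3 * ratio + - (ratio / 25)); lra.
by nra.
Qed.

(** With [lam = 1 / 2], Markov's inequality costs [u0 / 2] in the exponent against a gain of at
    least [u0], and [u0 >= n]. *)
Lemma run_unocc_early :
  run (milestone n k.+1) (indic (fun C : cluster n => INR (unocc_level C k) < u0)) start
  <= tiny n.
Proof.
have kn : (k <= n)%N by have := k_lt_n; lia.
have mn : INR n <= m by apply: (bin_n_ge n_large k0 k_small); lia.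
have m2 : (2 <= 'C(n, k))%N by apply: INR_leq; rewrite -/m -[INR 2]/2; lra.
have half : 0 <= 1 / 2 <= 1 / 2 by lra.
have := run_exp_unocc kn (milestone n k.+1) m2 (start_rooted n) half.
rewrite unocc_level_start -/m; set T := milestone n k.+1; set q := 1 - 2 / m => H.
apply: (@Rle_trans _ (run T (fun C : cluster n => exp (u0 / 2) * exp (- (1 / 2 * INR
  (unocc_level C k)))) start)).
  apply: run_leT => C; rewrite -exp_plus; apply: indic_le; first exact/Rlt_le/exp_pos.
  by move=> lt_u; set y := _ + _; have := exp_ineq1_le y; rewrite /y; lra.
rewrite run_scale.
apply: Rle_trans (Rmult_le_compat_l _ _ _ (Rlt_le _ _ (exp_pos _)) H) _.
rewrite -exp_plus; apply: exp_le.
(* Each factor is at least [exp (- 4 / m)], and there are at most [m * ratio / 100] of them. *)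
have qT : exp (- (ratio / 25)) <= q ^ T.
  have q_ge : exp (- (2 * (2 / m))) <= q.
    apply: exp_le_1sub; split; first by apply: Rle_divr; lra.
    by apply: Rle_divl; lra.
  apply: (@Rle_trans _ (exp (- (2 * (2 / m))) ^ T)); last first.
    by apply: pow_incr; split=> //; apply/Rlt_le/exp_pos.
  rewrite exp_pow; apply: exp_le.
  have [_ T_le] := milestone_bounds n k.+1; rewrite -/T binS_ratio in T_le.
  have -> : INR T * - (2 * (2 / m)) = - (INR T * 4 / m) by field; lra.
  apply: Ropp_le_contravar; apply: Rle_divl => //; lra.
have := u0_ge; have : u0 <= 1 / 2 * q ^ T * m.
  rewrite /u0; have -> : 1 / 2 * q ^ T * m = m / 2 * q ^ T by field.
  by apply: Rmult_le_compat_l; lra.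
by lra.
Qed.

Let B := weight_bound n k.

Lemma weight_bound_le : 0 < B <= exp (20 / 19 * ratio).
Proof.
have g1 := growth_ge1 k; split; first by apply: pow_lt; lra.
have := INR_gt0 (ltn0Sn k) => k1'.
apply: (@Rle_trans _ (exp (INR (n - k) * (20 / (19 * INR k.+1))))).
  by apply: pow_le_exp; split; [lra | apply: exp_ineq1_le].
apply: exp_le; rewrite INRB; last by have := k_lt_n; lia.
by right; rewrite /ratio; field; lra.
Qed.

Lemma run_unocc_late t (C : cluster n) : set0 \in C -> good k.+1 C ->
  u0 <= INR (unocc_level C k) ->
  run t (indic (fun D : cluster n => 2 * B * INR (unocc_level D k) < u0)) C <= tiny n.
Proof.
move=> C0 gC u_le; have kn : (k < n)%N by have := k_lt_n; lia.
have [B0 B_le] := weight_bound_le; have [r1 r2] := ratio_bounds.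
have B1 : 1 <= B by apply: pow_R1_Rle; apply: growth_ge1.
set N := INR ('C(n, k) + 'C(n, k.+1)).
have NE : N = m * (1 + ratio) by rewrite /N INRD binS_ratio -/m; ring.
have N0 : 0 < N by rewrite NE; apply: Rmult_lt_0_compat; lra.
have u_pos : 0 < u0 by have := u0_ge; lra.
have u_m : u0 <= m.
  rewrite /u0; have : exp (- (ratio / 25)) <= exp 0 by apply: exp_le; lra.
  by rewrite exp_0; nra.
(* The minimiser of [- lam * u0 / 2 + 8 * (lam * B) ^ 2 * N]; the minimum is
   [- u0 ^ 2 / (128 * B ^ 2 * N)]. *)
set lam := u0 / (32 * B ^ 2 * N).
have B2 : 0 < B ^ 2 by apply: pow_lt.
have D0 : 0 < 32 * B ^ 2 * N by apply: Rmult_lt_0_compat; lra.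
have lam0 : 0 <= lam by apply: Rle_divr; lra.
have lamB : 4 * lam * B <= 1.
  have -> : 4 * lam * B = u0 / (8 * B * N) by rewrite /lam; field; lra.
  apply: Rle_divl; first by apply: Rmult_lt_0_compat; lra.
  have : m <= N by rewrite NE; nra.
  by nra.
apply: Rle_trans (run_unocc_small kn t C0 gC u_le lam0 lamB) _.
rewrite -/B -/N; apply: exp_le.
have -> : - (lam * u0 / 2) + 8 * (lam * B) ^ 2 * N = - (u0 ^ 2 / (128 * B ^ 2 * N)).
  by rewrite /lam; field; lra.
apply: Ropp_le_contravar; apply: Rle_divr; first by apply: Rmult_lt_0_compat; lra.
(* The exponents to beat are [40 / 19] from [B ^ 2] and [1 / 2] from [N], in units of [ratio];
   [m_ge] offers [3], less [2 / 25] from [u0 ^ 2]. *)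
have B2_le : B ^ 2 <= exp (40 / 19 * ratio).
  have -> : 40 / 19 * ratio = INR 2 * (20 / 19 * ratio) by rewrite -[INR 2]/2; field.
  by apply: pow_le_exp; lra.
have N_le : N <= 4 * m * exp (ratio / 2).
  by rewrite NE; have := exp_ineq1_le (ratio / 2); nra.
have -> : u0 ^ 2 = m / 4 * exp (- (2 * ratio / 25)) * m.
  rewrite /u0 Rpow_mult_distr exp_pow.
  have -> : INR 2 * - (ratio / 25) = - (2 * ratio / 25) by rewrite -[INR 2]/2; field.
  by field.
apply: (@Rle_trans _ (INR n / 20000 * (128 * exp (40 / 19 * ratio) * (4 * m * exp (ratio /
  2))))).
  apply: Rmult_le_compat_l; first by lra.
  by apply: Rmult_le_compat; lra.
have -> : INR n / 20000 * (128 * exp (40 / 19 * ratio) * (4 * m * exp (ratio / 2))) =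
   512 / 20000 * INR n * (exp (40 / 19 * ratio) * exp (ratio / 2)) * m by field.
apply: Rmult_le_compat_r; first by lra.
rewrite -exp_plus.
apply: (@Rle_trans _ (exp (3 * ratio) * (2048 * INR n) / 4 * exp (- (2 * ratio / 25))));
  last first.
  by apply: Rmult_le_compat_r; [exact/Rlt_le/exp_pos | have := m_ge; lra].
have -> : exp (3 * ratio) * (2048 * INR n) / 4 * exp (- (2 * ratio / 25)) =
  512 * INR n * (exp (3 * ratio) * exp (- (2 * ratio / 25))) by field.
rewrite -exp_plus; apply: Rmult_le_compat; [lra | exact/Rlt_le/exp_pos | lra | apply:
  exp_le; lra].
Qed.

(** The constants fit because [10 / 9 - 20 / 19] exceeds [1 / 25]; the factor [1 - rho n k] is at
    most [1 / 2] by the second argument of the maximum. *)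
Lemma bound_le_u0 :
  2 * B * ((1 - rho n k) * exp (- (10 * INR n / (9 * INR k))) / 2 * INR 'C(n, k)) <= u0.
Proof.
have [B0 B_le] := weight_bound_le; have [r1 r2] := ratio_bounds.
have rho_le : 1 - rho n k <= 1 / 2.
  rewrite /rho; have := Rmax_r (1 - (INR (k + 1) / (exp 1 * INR n)) ^ 100) (1 - (1 / (10 *
    exp 1)) ^ 10).
  have : (1 / (10 * exp 1)) ^ 10 <= (1 / 10) ^ 10.
    apply: pow_incr; have e1 := exp_ineq1_le 1.
    split; first by apply: Rle_divr; lra.
    by apply: Rle_divl; lra.
  by lra.
set E := exp (- (10 * INR n / (9 * INR k))); have E0 : 0 < E by apply: exp_pos.
rewrite -/m.
have -> : 2 * B * ((1 - rho n k) * E / 2 * m) = (1 - rho n k) * (B * E * m) by field.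
apply: (@Rle_trans _ (1 / 2 * (B * E * m))).
  apply: Rmult_le_compat_r => //; apply: Rmult_le_pos; last by lra.
  by apply: Rmult_le_pos; lra.
have -> : 1 / 2 * (B * E * m) = m / 2 * (B * E) by field.
apply: Rmult_le_compat_l; first by lra.
apply: (@Rle_trans _ (exp (20 / 19 * ratio) * E)); first by apply: Rmult_le_compat_r; lra.
rewrite /E -exp_plus; apply: exp_le.
have -> : 10 * INR n / (9 * INR k) = 10 / 9 * (INR n / INR k) by field; lra.
by lra.
Qed.

Lemma run_level_bound :
  run (2 ^ n) (indic (fun C : cluster n => INR (unocc_level C k) <
     (1 - rho n k) * exp (- (10 * INR n / (9 * INR k))) / 2 * INR 'C(n, k))) start
  <= 5 * INR n * tiny n.
Proof.
have T_le : (milestone n k.+1 <= 2 ^ n)%N.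
  apply: leq_trans (leq_div _ _) _; apply: INR_leq; rewrite INRX.
  have := @bin_mul_pow_le n k.+1 1; rewrite pow1 Rmult_1_r => H.
  by apply: H; lra.
rewrite -(subnKC T_le) runD; set t := (2 ^ n - _)%N.
set bound := (1 - rho n k) * _ / 2 * _; have b_le : 2 * B * bound <= u0 := bound_le_u0.
have [B0 B_le] := weight_bound_le.
have t0 : 0 < tiny n by apply: exp_pos.
(* Split at the milestone: [good] fails, or too few vertices are left, or the later phase loses too
   many. *)
apply: (@Rle_trans _ (run (milestone n k.+1) (fun C : cluster n =>
   indic (fun C : cluster n => ~ good k.+1 C) C + indic (fun C : cluster n => INR
     (unocc_level C k) < u0) C + tiny n) start)).
  apply: (@run_le _ (fun C => set0 \in C)); [exact: stable_rooted| |exact: start_rooted].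
  move=> C C0.
  have i1 := indic_ge0 (fun C : cluster n => ~ good k.+1 C) C.
  have i2 := indic_ge0 (fun C : cluster n => INR (unocc_level C k) < u0) C.
  have run1 : run t (indic (fun C : cluster n => INR (unocc_level C k) < bound)) C <= 1.
    rewrite -[X in _ <= X](@run_cst n t 1 C); apply: run_leT => D; exact: indic_le1.
  have [gC|ngC] := classic (good k.+1 C); last first.
    by rewrite [indic (fun C => ~ _) C]indicT //; lra.
  have [lt_u|/Rnot_lt_le u_le] := classic (INR (unocc_level C k) < u0).
    by rewrite [indic (fun C => _ < _) C]indicT //; lra.
  apply: (@Rle_trans _ (tiny n)); last by lra.
  apply: Rle_trans (run_unocc_late t C0 gC u_le).
  apply: run_leT => D; apply: indic_le; first exact: indic_ge0.
  move=> lt_b; rewrite indicT; first by lra.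
  by nra.
rewrite !run_add run_cst.
have := run_unocc_early; have kn := leqnn k.+1.
have := @run_not_good_le n k n_large k0 k_small k.+1 kn.
rewrite subSS subn0; set R1 := run _ _ _; set R2 := run _ _ _ => R1_le R2_le.
have : R1 + R2 + tiny n <= 3 * INR k * tiny n + tiny n + tiny n by lra.
have : INR k * tiny n <= INR n * tiny n by apply: Rmult_le_compat_r; lra.
have : 1 * tiny n <= INR n * tiny n by apply: Rmult_le_compat_r; lra.
by lra.
Qed.

End LevelCount.

(** * Union bound over the levels and conclusion *)

Section Union.
Variables (n : nat) (eps : R).
Hypotheses (n_large : 1000000 <= INR n) (eps0 : 0 < eps) (eps1 : eps < 1 / 100).

Definition level_range k :=
  sqrt (100 * INR n / ln (INR n)) <= INR k /\ INR k < eps ^ 3 * INR n.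

(** The factor [1000000] comes from [eps ^ 3 <= (1 / 100) ^ 3]. *)
Lemma level_rangeP k : level_range k ->
  [/\ (0 < k)%N, 1000000 * INR k <= INR n & 100 * INR n / ln (INR n) <= INR k ^ 2].
Proof.
move=> [lo hi].
have e3 : eps ^ 3 <= (1 / 100) ^ 3 by apply: pow_incr; lra.
have ln0 : 0 < ln (INR n) by rewrite -ln_1; apply: ln_increasing; lra.
have q0 : 0 < 100 * INR n / ln (INR n) by apply: Rdiv_lt_0_compat; lra.
split.
- apply/ltP/INR_lt; rewrite /=; have := sqrt_lt_R0 _ q0; lra.
- by nra.
- rewrite -[X in X <= _]sqrt_sqrt; last by lra.
  have := sqrt_pos (100 * INR n / ln (INR n)); move=> s0.
  by rewrite /= Rmult_1_r; apply: Rmult_le_compat.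
Qed.

Definition sparse_level k (C : cluster n) :=
  level_range k /\ INR (unocc_level C k) <
     (1 - rho n k) * exp (- (10 * INR n / (9 * INR k))) / 2 * INR 'C(n, k).

(** After [2 ^ n] steps the process has ended, so the event can fail only through one of the levels
    below [n], each with probability at most [5 * n * tiny n]. *)
Lemma dla_prob_event4 : 1 - 5 * INR n ^ 2 * tiny n <= dla_prob (@event4 100 eps n).
Proof.
rewrite /dla_prob reachE.
set G := fun C : cluster n => if _ then indic _ C else 0.
have t0 : 0 < tiny n by apply: exp_pos.
have split (C : cluster n) : 1 <= G C + (if setT \in C then 0 else 1) +
    \big[Rplus/0]_(k < n) indic (sparse_level k) C.
  have S0 : 0 <= \big[Rplus/0]_(k < n) indic (sparse_level k) C.
    by apply: rsum_ge0 => k _; apply: indic_ge0.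
  rewrite /G; case: ifP => CT; last by lra.
  have [ev|nev] := classic (event4 100 eps C); first by rewrite indicT //; lra.
  rewrite indicF // !Rplus_0_l.
  have [k sp] : exists k, sparse_level k C.
    apply: NNPP => none; apply: nev => k lo hi; apply: Rnot_lt_le => lt_u.
    by apply: none; exists k.
  have kn : (k < n)%N.
    case: (sp) => /level_rangeP[k0 k_small _] _; apply: INR_leq; rewrite S_INR.
    have : 1 <= INR k by apply: k_ge1.
    by lra.
  rewrite (bigD1 (Ordinal kn)) //= indicT //.
  set S := \big[_/_]_(_ | _) _.
  have : 0 <= S by apply: rsum_ge0 => j _; apply: indic_ge0.
  by lra.
have := run_leT (2 ^ n) start split; rewrite run_cst !run_add run_sum.
rewrite run_terminates ?start_rooted //; last by rewrite cards1; lia.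
have : \big[Rplus/0]_(k < n) run (2 ^ n) (indic (sparse_level k)) start <=
    \big[Rplus/0]_(k < n) (5 * INR n * tiny n).
  apply: rsum_le => k _; have [lr|nlr] := classic (level_range k).
    have [k0 k_small k_large] := level_rangeP lr.
    apply: Rle_trans (run_level_bound n_large k0 k_small k_large).
    apply: run_leT => C; apply: indic_le; first exact: indic_ge0.
    by case=> _ lt_u; rewrite indicT //; lra.
  apply: (@Rle_trans _ 0); last by apply: Rmult_le_pos; lra.
  rewrite -[X in _ <= X](@run_cst n (2 ^ n) 0 start); apply: run_leT => C.
  by rewrite indicF; [lra | case].
rewrite rsum_const card_ord; set S := \big[_/_]_(_ < _) _ => S_le.
rewrite -/start; set X := run _ G _.
by lra.
Qed.

End Union.

(** Bounding [exp (n / 20000)] below by the cube [(n / 60000) ^ 3] leaves a spare factor [n] against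
    [n ^ 2]. *)
Lemma union_bound_small n delta : 0 < delta -> 1000000 <= INR n ->
  5 * 60000 ^ 3 / delta <= INR n -> 5 * INR n ^ 2 * tiny n <= delta.
Proof.
move=> d0 n_large n_delta; rewrite /tiny exp_Ropp.
have e3 : (INR n / 60000) ^ 3 <= exp (INR n / 20000).
  have -> : INR n / 20000 = INR 3 * (INR n / 60000) by rewrite INR_3; field.
  rewrite -exp_pow; apply: pow_incr.
  by split; [lra | have := exp_ineq1_le (INR n / 60000); lra].
have p0 : 0 < (INR n / 60000) ^ 3 by apply: pow_lt; lra.
apply: Rle_divl; first exact: exp_pos.
apply: (@Rle_trans _ (delta * (INR n / 60000) ^ 3)); last by apply: Rmult_le_compat_l; lra.
have dn : 5 * 60000 ^ 3 <= INR n * delta.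
  have -> : 5 * 60000 ^ 3 = 5 * 60000 ^ 3 / delta * delta by field; lra.
  by apply: Rmult_le_compat_r; lra.
have -> : delta * (INR n / 60000) ^ 3 = INR n * delta * (INR n ^ 2 / 60000 ^ 3) by field.
have -> : 5 * INR n ^ 2 = 5 * 60000 ^ 3 * (INR n ^ 2 / 60000 ^ 3) by field.
apply: Rmult_le_compat_r => //; apply: Rle_divr; first by lra.
by rewrite Rmult_0_l; apply: pow2_ge_0.
Qed.

Theorem theorem4 :
  exists c1 : R, 0 < c1 /\
  forall eps : R, 0 < eps -> eps < 1 / 100 ->
  forall delta : R, 0 < delta ->
  exists N : nat, forall n : nat, (N <= n)%N ->
    1 - delta <= dla_prob (@event4 c1 eps n).
Proof.
(* The value [100] provides [100 * n / ln n <= k ^ 2], from which [log_ratio_large] and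
   [exp_half_k_ge] follow. *)
exists 100; split; first by lra.
move=> eps eps0 eps1 delta delta0.
have [N N_gt] := INR_unbounded (Rmax 1000000 (5 * 60000 ^ 3 / delta)).
exists N => n /leq_INR Nn.
have := Rmax_l 1000000 (5 * 60000 ^ 3 / delta); have := Rmax_r 1000000 (5 * 60000 ^ 3 / delta).
move=> n2 n1; have n_large : 1000000 <= INR n by lra.
have := dla_prob_event4 n_large eps0 eps1.
have : 5 * INR n ^ 2 * tiny n <= delta by apply: union_bound_small; lra.
by lra.
Qed.
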